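(* Let $\dim V=3$ and let $a,b\ge 0$ be integers. Set $\mu=(a+b+1,a)$ and $\nu=(a+b+1,a+1)$. Let $T_{a,b}\in V^*\otimes S_\mu V^*\otimes S_\nu V$ be the nonzero $GL(V)$-invariant tensor, which is unique up to scale. Then $\underline{R}(T_{a,b})$ satisfies the following lower bounds: - for $a=0$ and $b=0,1,2,3,4$: $\underline{R}\ge 5,10,17,26,37$ respectively; - for $a=1$ and $b=0,1,2,3$: $\underline{R}\ge 10,19,31,46$; - for $a=2$ and $b=0,1,2$: $\underline{R}\ge 17,31,49$; - for $a=3$ and $b=0,1$: $\underline{R}\ge 26,46$; - for $a=4$ and $b=0$: $\underline{R}\ge 37$.
   Context: $S_\lambda V$ denotes the irreducible polynomial $GL(V)$-module indexed by the partition $\lambda$. Here $\dim S_\mu V=\frac{(a+b+3)(a+1)(b+2)}{2}$ and $\dim S_\nu V=\frac{(a+b+3)(a+2)(b+1)}{2}$. The border rank $\underline{R}(T)$ is the smallest $r$ such that $T$ is a limit of sums of $r$ rank-one tensors. *)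

(* Defs.v *)
(* complex numbers are R[i] for an arbitrary R : realType
   (every realType is a complete archimedean ordered field, i.e. a copy of ℝ). *)
From mathcomp Require Import all_boot all_order all_algebra.
From mathcomp Require Import reals.
From mathcomp.real_closed Require Export complex.

Set Implicit Arguments.
Unset Strict Implicit.
Unset Printing Implicit Defensive.

Import GRing.Theory Num.Theory.
Local Open Scope ring_scope.

Section Defs.
Variable R : realType.
Local Notation C := R[i].

Definition cvgC (z : nat -> C) (l : C) : Prop :=
  forall eps : R, 0 < eps ->
    exists N : nat, forall n : nat, (N <= n)%N -> `|z n - l| < (eps%:C)%C.

Definition tensor (n1 n2 n3 : nat) := 'I_n1 -> 'I_n2 -> 'I_n3 -> C.

Definition sum_rank1 (n1 n2 n3 r : nat) (x : 'I_r -> 'rV[C]_n1)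
    (y : 'I_r -> 'rV[C]_n2) (z : 'I_r -> 'rV[C]_n3) : tensor n1 n2 n3 :=
  fun i j k => \sum_(l < r) x l 0 i * y l 0 j * z l 0 k.

Definition border_rank_le (n1 n2 n3 : nat) (T : tensor n1 n2 n3) (r : nat) : Prop :=
  exists (x : nat -> 'I_r -> 'rV[C]_n1) (y : nat -> 'I_r -> 'rV[C]_n2)
         (z : nat -> 'I_r -> 'rV[C]_n3),
    forall i j k, cvgC (fun n => sum_rank1 (x n) (y n) (z n) i j k) (T i j k).

Inductive polyfun : ('M[C]_3 -> C) -> Prop :=
  | pf_const (c : C) : polyfun (fun _ => c)
  | pf_coord (i j : 'I_3) : polyfun (fun g => g i j)
  | pf_add f h : polyfun f -> polyfun h -> polyfun (fun g => f g + h g)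
  | pf_mul f h : polyfun f -> polyfun h -> polyfun (fun g => f g * h g).

(** A (row-vector convention) representation rho of GL_3(C) on C^N:
    v |-> v *m rho g, with rho (g *m h) = rho g *m rho h. *)
Definition GLrep (N : nat) (rho : 'M[C]_3 -> 'M[C]_N) : Prop :=
  rho 1%:M = 1%:M /\
  forall g h, g \in unitmx -> h \in unitmx -> rho (g *m h) = rho g *m rho h.

Definition polynomial_rep (N : nat) (rho : 'M[C]_3 -> 'M[C]_N) : Prop :=
  forall i j, exists f, polyfun f /\ forall g, g \in unitmx -> rho g i j = f g.

Definition irreducible_rep (N : nat) (rho : 'M[C]_3 -> 'M[C]_N) : Prop :=
  (0 < N)%N /\
  forall m (U : 'M[C]_(m, N)),
    (forall g, g \in unitmx -> (U *m rho g <= U)%MS) ->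
    U == 0 \/ row_full U.

(** Its character restricted to the torus is the Schur polynomial s_lam,
    given by Jacobi's bialternant formula
    s_lam(t) * det(t_i^(3-1-j)) = det(t_i^(lam_j + 3-1-j)). *)
Definition schur_character (lam : 'I_3 -> nat) (N : nat)
    (rho : 'M[C]_3 -> 'M[C]_N) : Prop :=
  forall t : 'I_3 -> C, (forall i, t i != 0) ->
    \tr (rho (diag_mx (\row_i t i))) * \det (\matrix_(i, j < 3) t i ^+ (2 - j))
    = \det (\matrix_(i, j < 3) t i ^+ (lam j + (2 - j))).

Definition schur_module (lam : 'I_3 -> nat) (N : nat) (rho : 'M[C]_3 -> 'M[C]_N) : Prop :=
  [/\ GLrep rho, polynomial_rep rho, irreducible_rep rho & schur_character lam rho].

Definition part3 (l1 l2 l3 : nat) : 'I_3 -> nat :=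
  fun j => nth 0%N [:: l1; l2; l3] j.

(** T ∈ V* ⊗ A* ⊗ B (coordinates w.r.t. dual bases) is GL(V)-invariant,
    i.e. the bilinear map (v, w) |-> sum_(i,j) v_i w_j T i j _ is equivariant:
    phi(v *m g, w *m rhoA g) = phi(v, w) *m rhoB g. *)
Definition invariant_tensor (NA NB : nat) (rhoA : 'M[C]_3 -> 'M[C]_NA)
    (rhoB : 'M[C]_3 -> 'M[C]_NB) (T : tensor 3 NA NB) : Prop :=
  forall g, g \in unitmx -> forall i j k,
    \sum_(i' < 3) \sum_(j' < NA) g i i' * rhoA g j j' * T i' j' k
    = \sum_(k' < NB) T i j k' * rhoB g k' k.

Definition nonzero_tensor (n1 n2 n3 : nat) (T : tensor n1 n2 n3) : Prop :=
  exists i j k, T i j k != 0.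

End Defs.

Definition bound_table : seq (nat * nat * nat) :=
  [:: (0, 0, 5); (0, 1, 10); (0, 2, 17); (0, 3, 26); (0, 4, 37);
      (1, 0, 10); (1, 1, 19); (1, 2, 31); (1, 3, 46);
      (2, 0, 17); (2, 1, 31); (2, 2, 49);
      (3, 0, 26); (3, 1, 46);
      (4, 0, 37)]%N.

(* Main.v *)
(** Let T_i be the slices of T along V^*. Equip the space of matrices Y (of size dim S_nu by
    dim S_mu) with the action Y |-> rho_nu(g) Y rho_mu(g^T); then Omega(Y) = sum_i T_i Y T_i
    intertwines it with the analogous action on its target. If T is approximated by a sum
    T' of r rank-one tensors x_l (x) y_l (x) z_l, the map sum_i T'_i Y T_i equals
    sum_l y_l^T (z_l Y (sum_i x_l,i T_i)), which has rank at most r * rho when every linear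
    combination of the T_i has rank at most rho. As Omega is injective, so is its
    approximation, whence dim S_mu * dim S_nu <= r * rho.

    Injectivity of Omega: a nonzero kernel would contain a nonzero Y fixed by the upper
    unipotent matrices, and such a Y is determined by eta = Y xi_mu, with xi_mu a highest
    weight vector. In the polynomial model of S_nu on a chart of the flag variety, Omega(Y) = 0
    becomes a differential equation whose coefficient recursion, together with the degree
    bounds that xi_mu imposes on eta, has only the zero solution.

    Bound rho: all nonzero combinations of the T_i have the rank of T_0, which shifts the
    grading of S_mu and S_nu by the weights of diag(u, 1, 1) by one, so that rho can be taken
    to be the sum of the minima of consecutive weight multiplicities. *)

Require Import Defs.
From mathcomp Require Import all_boot all_order all_algebra.
From mathcomp Require Import reals.
From mathcomp.real_closed Require Import complex.
From mathcomp Require Import boolp zify ring lra.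

Set Implicit Arguments.
Unset Strict Implicit.
Unset Printing Implicit Defensive.

Import Order.TTheory GRing.Theory Num.Theory.
Local Open Scope ring_scope.

(** The hypotheses give matrix representations with a prescribed character and no model of them. The
    explicit data are the matrix coefficients [v *m rho g *m xi] between a highest weight row and a
    highest weight column. An identity between vectors is therefore tested on an orbit, where
    irreducibility makes the test faithful, and becomes an identity of polynomials in the entries of
    [g]. No Lie algebra appears: a one-parameter subgroup is a matrix over [{poly C}], whose
    coefficients are the weight projections of a torus, and whose coefficient of degree 1 is the
    root vector of a unipotent subgroup. Plain flattenings of T cannot bound the border rank beyond
    the larger of the two dimensions. Pairing the approximated tensor with an exact copy of T
    enlarges the matrix to order dim S_mu * dim S_nu, while a rank-one term costs only the rank of a
    slice. The differential equation alone does not force zero: even among polynomials of degree at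
    most [a + 1] in [K] it has nonzero solutions. The bound [a] on the degree in [M], inherited from
    [xi_mu], excludes them. *)

Section PolynomialFamilies.
Variable F : numFieldType.

(** In characteristic 0 the naturals give more roots of [d * (p - q)] than its degree allows. This
    discards the parameters at which a curve leaves the group or the big cell. *)
Lemma poly_eq_generic (d p q : {poly F}) : d != 0 ->
  (forall u, d.[u] != 0 -> p.[u] = q.[u]) -> p = q.
Proof.
move=> d0 pq; apply/eqP; rewrite -subr_eq0.
suff: d * (p - q) == 0 by rewrite mulf_eq0 (negPf d0).
set f := d * _; apply: contraT => f0.
have := @max_poly_roots _ f [seq i%:R | i <- iota 0 (size f)] f0.
rewrite size_map size_iota ltnn; move=> ->//.
  apply/allP => _ /mapP[i _ ->]; apply/rootP; rewrite !hornerE.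
  by have [->|/pq ->] := eqVneq d.[i%:R] 0; rewrite ?mul0r ?subrr ?mulr0.
by rewrite map_inj_uniq ?iota_uniq // => i j /eqP; rewrite eqr_nat => /eqP.
Qed.

Lemma poly_eq_horner (p q : {poly F}) : (forall u, p.[u] = q.[u]) -> p = q.
Proof. by move=> pq; apply: (@poly_eq_generic 1); rewrite ?oner_eq0. Qed.

(** A matrix over [{poly F}] stands for a polynomial curve of matrices. Identities are checked on
    its values, where group laws apply, and exploited on its coefficients. *)
Definition evmx m n (u : F) (A : 'M[{poly F}]_(m, n)) : 'M[F]_(m, n) :=
  map_mx (horner_eval u) A.

Definition coefmx m n (k : nat) (A : 'M[{poly F}]_(m, n)) : 'M[F]_(m, n) :=
  map_mx (coefp k) A.

Lemma evmxE m n u (A : 'M[{poly F}]_(m, n)) i j : evmx u A i j = (A i j).[u].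
Proof. by rewrite mxE. Qed.

Lemma coefmxE m n k (A : 'M[{poly F}]_(m, n)) i j : coefmx k A i j = (A i j)`_k.
Proof. by rewrite mxE. Qed.

Lemma evmxM m n p u (A : 'M[{poly F}]_(m, n)) (B : 'M_(n, p)) :
  evmx u (A *m B) = evmx u A *m evmx u B.
Proof. exact: map_mxM. Qed.

Lemma evmx_polyC m n u (A : 'M[F]_(m, n)) : evmx u (map_mx polyC A) = A.
Proof. by apply/matrixP => i j; rewrite !mxE /horner_eval hornerC. Qed.

Lemma evmx_eq_generic m n (d : {poly F}) (A B : 'M[{poly F}]_(m, n)) : d != 0 ->
  (forall u, d.[u] != 0 -> evmx u A = evmx u B) -> A = B.
Proof.
move=> d0 AB; apply/matrixP => i j; apply: (poly_eq_generic d0) => u /AB.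
by move/matrixP/(_ i j); rewrite !evmxE.
Qed.

Lemma evmx_eq m n (A B : 'M[{poly F}]_(m, n)) :
  (forall u, u != 0 -> evmx u A = evmx u B) -> A = B.
Proof.
by move=> AB; apply: (@evmx_eq_generic _ _ 'X); rewrite ?polyX_eq0 // => u; rewrite hornerX; apply: AB.
Qed.

Lemma eq_coefmx m n (A B : 'M[{poly F}]_(m, n)) :
  (forall k, coefmx k A = coefmx k B) -> A = B.
Proof.
move=> AB; apply/matrixP => i j; apply/polyP => k.
by have /matrixP/(_ i j) := AB k; rewrite !coefmxE.
Qed.

Lemma coefmx_mull m n p k (A : 'M[F]_(m, n)) (B : 'M[{poly F}]_(n, p)) :
  coefmx k (map_mx polyC A *m B) = A *m coefmx k B.
Proof.
apply/matrixP => i j; rewrite !mxE /= coef_sum; apply: eq_bigr => l _.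
by rewrite !mxE coefCM.
Qed.

Lemma coefmx_mulr m n p k (A : 'M[{poly F}]_(m, n)) (B : 'M[F]_(n, p)) :
  coefmx k (A *m map_mx polyC B) = coefmx k A *m B.
Proof.
apply/matrixP => i j; rewrite !mxE /= coef_sum; apply: eq_bigr => l _.
by rewrite !mxE coefMC.
Qed.

Lemma coefmx_polyC m n k (A : 'M[F]_(m, n)) :
  coefmx k (map_mx polyC A) = if k == 0%N then A else 0.
Proof. by apply/matrixP => i j; rewrite !mxE /= coefC; case: ifP; rewrite ?mxE. Qed.

Lemma coefmxXn m n k l (A : 'M[{poly F}]_(m, n)) :
  coefmx k ('X^l *: A) = if (k < l)%N then 0 else coefmx (k - l) A.
Proof. by apply/matrixP => i j; rewrite !mxE /= coefXnM; case: ifP; rewrite ?mxE. Qed.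

Lemma evmxZXn m n u l (A : 'M[{poly F}]_(m, n)) : evmx u ('X^l *: A) = u ^+ l *: evmx u A.
Proof. by apply/matrixP => i j; rewrite !mxE /horner_eval !hornerE. Qed.

Lemma coefmx_bound m n (A : 'M[{poly F}]_(m, n)) :
  exists d, forall k, (d <= k)%N -> coefmx k A = 0.
Proof.
exists (\max_i \max_j size (A i j)) => k le_k; apply/matrixP => i j; rewrite !mxE /=.
apply/leq_sizeP: le_k; apply: leq_trans (leq_bigmax i); exact: leq_bigmax j.
Qed.

Lemma evmx_sum m n (A : 'M[{poly F}]_(m, n)) d u :
  (forall k, (d <= k)%N -> coefmx k A = 0) ->
  evmx u A = \sum_(k < d) u ^+ k *: coefmx k A.
Proof.
move=> dA; apply/matrixP => i j; rewrite evmxE summxE (@horner_coef_wide _ d).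
  by apply: eq_bigr => k _; rewrite !mxE mulrC.
by apply/leq_sizeP => k /dA/matrixP/(_ i j); rewrite !mxE.
Qed.

Definition dilate m n (v : F) (A : 'M[{poly F}]_(m, n)) : 'M[{poly F}]_(m, n) :=
  map_mx (fun p => p \Po (v *: 'X)) A.

Lemma evmx_dilate m n v u (A : 'M[{poly F}]_(m, n)) : evmx u (dilate v A) = evmx (v * u) A.
Proof. by apply/matrixP => i j; rewrite !mxE /horner_eval horner_comp !hornerE. Qed.

Lemma coefmx_dilate m n v k (A : 'M[{poly F}]_(m, n)) :
  coefmx k (dilate v A) = v ^+ k *: coefmx k A.
Proof.
apply/matrixP => i j; rewrite !mxE /= -mul_polyC comp_polyE coef_sum.
have [lt_k|le_k] := ltnP k (size (A i j)); last first.
  rewrite nth_default // mulr0 big1 // => h _.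
  rewrite exprMn -rmorphXn coefZ coefCM coefXn /=; case: eqP; last by rewrite !mulr0.
  by move=> E; rewrite leqNgt E ltn_ord in le_k.
rewrite (bigD1 (Ordinal lt_k)) //= big1 ?addr0; last first.
  move=> h; rewrite -val_eqE /= => nh.
  by rewrite exprMn -rmorphXn coefZ coefCM coefXn eq_sym (negPf nh) !mulr0.
by rewrite exprMn -rmorphXn coefZ coefCM coefXn eqxx mulr1 mulrC.
Qed.

(** Since [f] acts on matrices over [F] only, the curve [B'] built from the images of the
    coefficients of [A] plays the part of [f] applied to [A]; it agrees with [B] at all [u != 0]. *)
Lemma linear_coefmx m n p q (f : {linear 'M[F]_(m, n) -> 'M[F]_(p, q)})
    (A : 'M[{poly F}]_(m, n)) (B : 'M[{poly F}]_(p, q)) :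
  (forall u, u != 0 -> f (evmx u A) = evmx u B) ->
  forall k, f (coefmx k A) = coefmx k B.
Proof.
move=> fAB k; have [d dA] := coefmx_bound A.
pose B' : 'M[{poly F}]_(p, q) := \sum_(l < d) 'X^l *: map_mx polyC (f (coefmx l A)).
have cB' l : coefmx l B' = f (coefmx l A).
  apply/matrixP => i j; rewrite coefmxE summxE coef_sum.
  have [lt_l|le_l] := ltnP l d; last first.
    rewrite dA // linear0 mxE big1 // => h _; rewrite !mxE coefXnM coefC.
    by case: ltnP => // _; rewrite subn_eq0 leqNgt (leq_trans (ltn_ord h) le_l).
  rewrite (bigD1 (Ordinal lt_l)) //= big1 ?addr0; last first.
    move=> h; rewrite -val_eqE /= => nh; rewrite !mxE coefXnM coefC.
    by case: ltnP => // le_hl; rewrite subn_eq0 leqNgt ltn_neqAle nh le_hl.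
  by rewrite !mxE coefXnM ltnn subnn coefC.
suff -> : B = B' by rewrite cB'.
apply: evmx_eq => u u0; rewrite -fAB // (evmx_sum _ dA) linear_sum.
apply/matrixP => i j; rewrite !mxE /horner_eval !summxE horner_sum; apply: eq_bigr => l _.
by rewrite linearZ !mxE !hornerE.
Qed.

(** In a full rank factorisation [P = c *m r], idempotence cancels to [r *m c = 1], of size the
    rank. This converts characters into ranks. *)
Lemma idempotent_trace n (P : 'M[F]_n) : P *m P = P -> \tr P = (\rank P)%:R.
Proof.
move=> PP; have := mulmx_base P; have := row_base_free P; have := col_base_full P.
move: (col_base P) (row_base P) => c r fc fr cr.
suff rc1 : r *m c = 1%:M by rewrite -{1}cr mxtrace_mulC rc1 mxtrace1.
have: c *m (r *m c - 1%:M) *m r = 0.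
  by rewrite mulmxBr mulmx1 mulmxBl -!mulmxA cr mulmxA cr PP subrr.
rewrite -[RHS](mul0mx _ r) => /(row_free_inj fr).
rewrite -[RHS](mulmx0 _ c) => /(row_full_inj fc) /eqP.
by rewrite subr_eq0 => /eqP.
Qed.

End PolynomialFamilies.

(** * Regular functions on GL_3 and density of principal open sets *)

Section RegularFunctions.
Variable R : realType.
Local Notation C := R[i].

Definition regular (f : 'M[C]_3 -> C) : Prop :=
  exists p, polyfun p /\ forall g, g \in unitmx -> f g = p g.

Lemma polyfun_regular f : polyfun f -> regular f.
Proof. by move=> pf; exists f. Qed.

Lemma eq_regular f h : (forall g, g \in unitmx -> f g = h g) -> regular f -> regular h.
Proof.
by move=> fh [p [pp fp]]; exists p; split=> // g ug; rewrite -fh ?fp.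
Qed.

Lemma regularD f h : regular f -> regular h -> regular (fun g => f g + h g).
Proof.
move=> [p [pp fp]] [q [pq fq]]; exists (fun g => p g + q g).
by split=> [|g ug]; [exact: pf_add | rewrite fp ?fq].
Qed.

Lemma regularM f h : regular f -> regular h -> regular (fun g => f g * h g).
Proof.
move=> [p [pp fp]] [q [pq fq]]; exists (fun g => p g * q g).
by split=> [|g ug]; [exact: pf_mul | rewrite fp ?fq].
Qed.

Lemma regular_const c : regular (fun=> c).
Proof. exact/polyfun_regular/pf_const. Qed.

Lemma regularX f n : regular f -> regular (fun g => f g ^+ n).
Proof.
move=> rf; elim: n => [|n IHn]; first exact: regular_const.
by apply: eq_regular (regularM rf IHn) => g _; rewrite exprS.
Qed.

Lemma regular_sum I (r : seq I) (P : pred I) (f : I -> 'M[C]_3 -> C) :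
  (forall i, regular (f i)) -> regular (fun g => \sum_(i <- r | P i) f i g).
Proof.
move=> rf; elim: r => [|i r IHr].
  by apply: eq_regular (regular_const 0) => g _; rewrite big_nil.
case Pi: (P i); last by apply: eq_regular IHr => g _; rewrite big_cons Pi.
by apply: eq_regular (regularD (rf i) IHr) => g _; rewrite big_cons Pi.
Qed.

Lemma polyfun_curve f (g : 'M[{poly C}]_3) :
  polyfun f -> exists p : {poly C}, forall u, p.[u] = f (evmx u g).
Proof.
elim=> [c|i j|f1 f2 _ [p1 e1] _ [p2 e2]|f1 f2 _ [p1 e1] _ [p2 e2]].
- by exists c%:P => u; rewrite hornerC.
- by exists (g i j) => u; rewrite evmxE.
- by exists (p1 + p2) => u; rewrite hornerD e1 e2.
- by exists (p1 * p2) => u; rewrite hornerM e1 e2.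
Qed.

Lemma det_evmx n (g : 'M[{poly C}]_n) u : \det (evmx u g) = (\det g).[u].
Proof. by rewrite det_map_mx. Qed.

(** On the line from 1 to [g], both [d] and the determinant are nonzero at the origin, so [f]
    vanishes at all but finitely many points of the line, hence at [g]. *)
Lemma regular_eq0 f d : regular f -> polyfun d -> d 1%:M != 0 ->
  (forall g, g \in unitmx -> d g != 0 -> f g = 0) ->
  forall g, g \in unitmx -> f g = 0.
Proof.
move=> [q [pq fq]] pd d1 f0 g ug.
pose c : 'M[{poly C}]_3 := map_mx polyC 1%:M + 'X *: map_mx polyC (g - 1%:M).
have ec u : evmx u c = 1%:M + u *: (g - 1%:M).
  by apply/matrixP => i j; rewrite !mxE /horner_eval !hornerE.
have [p ep] := polyfun_curve c pq; have [e ee] := polyfun_curve c pd.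
have e1 : evmx 0 c = 1%:M by rewrite ec scale0r addr0.
have eg : evmx 1 c = g by rewrite ec scale1r addrC subrK.
rewrite fq // -eg -ep; suff -> : p = 0 by rewrite horner0.
apply: (@poly_eq_generic _ (e * \det c)) => [|u].
  rewrite mulf_eq0 negb_or; apply/andP; split.
    by apply: contraNneq d1 => e0; rewrite -e1 -ee e0 horner0.
  apply/eqP => /(congr1 (horner^~ 0)); rewrite horner0 -det_evmx e1 det1.
  by move/eqP; rewrite oner_eq0.
rewrite hornerM mulf_eq0 negb_or ee -det_evmx -unitfE horner0 => /andP[d0 uc].
by rewrite ep -fq ?unitmxE // f0 // unitmxE.
Qed.

Lemma sum3 (V : nmodType) (f : 'I_3 -> V) : \sum_(i < 3) f i = f 0 + f 1 + f 2.
Proof.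
rewrite !big_ord_recl big_ord0 addr0 addrA.
by do 2?congr (_ + _); congr f; apply: val_inj.
Qed.

Lemma ord3P (P : 'I_3 -> Prop) : P 0 -> P 1 -> P 2 -> forall i, P i.
Proof.
move=> p0 p1 p2 [[|[|[|//]]] lt_i].
- by rewrite (_ : Ordinal _ = 0) //; apply: val_inj.
- by rewrite (_ : Ordinal _ = 1) //; apply: val_inj.
- by rewrite (_ : Ordinal _ = 2) //; apply: val_inj.
Qed.

End RegularFunctions.

(** * Polynomial representations along curves, and torus gradings *)

Section PolynomialRepresentations.
Variable R : realType.
Local Notation C := R[i].
Variables (N : nat) (rho : 'M[C]_3 -> 'M[C]_N).
Hypotheses (rhoG : GLrep rho) (rhoP : polynomial_rep rho).

Lemma rep1 : rho 1%:M = 1%:M. Proof. by case: rhoG. Qed.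

Lemma repM g h : g \in unitmx -> h \in unitmx -> rho (g *m h) = rho g *m rho h.
Proof. by case: rhoG => _; apply. Qed.

Lemma repK g : g \in unitmx -> rho g *m rho (invmx g) = 1%:M.
Proof. by move=> ug; rewrite -repM ?unitmx_inv // mulmxV ?rep1. Qed.

Lemma repVK g : g \in unitmx -> rho (invmx g) *m rho g = 1%:M.
Proof. by move=> ug; rewrite -repM ?unitmx_inv // mulVmx ?rep1. Qed.

Lemma rep_unit g : g \in unitmx -> rho g \in unitmx.
Proof. by move=> ug; case/mulmx1_unit: (repK ug). Qed.

Lemma rep_regular i j : regular (fun g => rho g i j).
Proof. exact: rhoP. Qed.

Lemma rep_coef_regular m n (v : 'M[C]_(m, N)) (w : 'M[C]_(N, n)) i j :
  regular (fun g => (v *m rho g *m w) i j).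
Proof.
apply: (@eq_regular _ (fun g => \sum_k (\sum_l v i l * rho g l k) * w k j)) => [g _|].
  by rewrite !mxE; apply: eq_bigr => k _; rewrite !mxE.
apply: regular_sum => k; apply: regularM; last exact: regular_const.
apply: regular_sum => l; apply: regularM; first exact: regular_const.
exact: rep_regular.
Qed.

Lemma rep_curve (g : 'M[{poly C}]_3) : exists A : 'M[{poly C}]_N,
  forall u, evmx u g \in unitmx -> rho (evmx u g) = evmx u A.
Proof.
have /fin_all_exists[A eA] : forall ij : 'I_N * 'I_N, exists p : {poly C},
    forall u, evmx u g \in unitmx -> rho (evmx u g) ij.1 ij.2 = p.[u].
  move=> [i j]; have [f [pf rf]] := rhoP i j; have [p ep] := polyfun_curve g pf.
  by exists p => u uu; rewrite rf // ep.
exists (\matrix_(i, j) A (i, j)) => u uu; apply/matrixP => i j.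
by rewrite evmxE mxE (eA (i, j) u uu).
Qed.

Definition torus (w : 'I_3 -> nat) (u : C) : 'M[C]_3 := diag_mx (\row_i u ^+ w i).

Lemma torus_unit w u : u != 0 -> torus w u \in unitmx.
Proof.
move=> u0; rewrite unitmxE det_diag unitfE; apply/prodf_neq0 => i _.
by rewrite mxE expf_neq0.
Qed.

Lemma torusM w u v : torus w (u * v) = torus w u *m torus w v.
Proof.
by rewrite mulmx_diag; congr diag_mx; apply/rowP => i; rewrite !mxE exprMn.
Qed.

Lemma torus1 w : torus w 1 = 1%:M.
Proof.
by rewrite -diag_const_mx; congr diag_mx; apply/rowP => i; rewrite !mxE expr1n.
Qed.

(** The coefficients of [A] are the projections onto the weight spaces: comparing coefficients of
    [v], then of [u], in [A(u) A(v) = A(u v)] makes them orthogonal idempotents, and [u = 1] makes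
    them sum to the identity. *)
Lemma torus_grading w : exists A : 'M[{poly C}]_N,
  [/\ forall u, u != 0 -> rho (torus w u) = evmx u A,
      forall k l, coefmx k A *m coefmx l A = if k == l then coefmx k A else 0
    & evmx 1 A = 1%:M].
Proof.
pose g : 'M[{poly C}]_3 := diag_mx (\row_i 'X^(w i)).
have eg u : evmx u g = torus w u.
  apply/matrixP => i j; rewrite !mxE /horner_eval.
  by case: eqP => _; rewrite ?mulr1n ?mulr0n !hornerE.
have [A eA] := rep_curve g; exists A.
have rA u : u != 0 -> rho (torus w u) = evmx u A.
  by move=> u0; rewrite -eg eA // eg torus_unit.
split=> //; last by rewrite -rA ?oner_eq0 // torus1 rep1.
move=> k l.
have h1 u : u != 0 -> evmx u A *m coefmx l A = u ^+ l *: coefmx l A.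
  move=> u0; rewrite -coefmx_dilate.
  apply: (@linear_coefmx _ _ _ _ _ (mulmx (evmx u A))) => v v0 /=.
  by rewrite -!rA // -repM ?torus_unit // -torusM rA ?mulf_neq0 // evmx_dilate.
have -> : (if k == l then coefmx k A else 0) = coefmx k ('X^l *: map_mx polyC (coefmx l A)).
  rewrite coefmxXn coefmx_polyC subn_eq0.
  by case: (ltngtP k l) => // ->.
apply: (@linear_coefmx _ _ _ _ _ (mulmxr (coefmx l A))) => v v0 /=.
by rewrite h1 // evmxZXn evmx_polyC.
Qed.

Section Grading.
Variable A : 'M[{poly C}]_N.
Hypothesis PP : forall k l, coefmx k A *m coefmx l A = if k == l then coefmx k A else 0.

Lemma grading_mulr l : A *m map_mx polyC (coefmx l A) = 'X^l *: map_mx polyC (coefmx l A).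
Proof.
apply: eq_coefmx => k; rewrite coefmx_mulr PP coefmxXn coefmx_polyC subn_eq0.
by case: ltngtP => // <-.
Qed.

Lemma grading_mull l : map_mx polyC (coefmx l A) *m A = 'X^l *: map_mx polyC (coefmx l A).
Proof.
apply: eq_coefmx => k; rewrite coefmx_mull PP coefmxXn coefmx_polyC subn_eq0.
by rewrite eq_sym; case: ltngtP => // <-.
Qed.

End Grading.

End PolynomialRepresentations.

(** * Highest weight vectors *)

Section HighestWeight.
Variable R : realType.
Local Notation C := R[i].

Lemma det3 (K : comNzRingType) (M : 'M[K]_3) : \det M =
  M 0 0 * (M 1 1 * M 2 2 - M 1 2 * M 2 1) - M 0 1 * (M 1 0 * M 2 2 - M 1 2 * M 2 0)
  + M 0 2 * (M 1 0 * M 2 1 - M 1 1 * M 2 0).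
Proof.
have det2 (B : 'M[K]_2) : \det B = B 0 0 * B 1 1 - B 0 1 * B 1 0.
  rewrite (expand_det_row _ 0) !big_ord_recl big_ord0 addr0 /cofactor !det_mx11 !mxE /=.
  rewrite expr0 expr1 mul1r mulN1r mulrN; congr (_ * _ - _ * _); congr (B _ _);
  exact: val_inj.
rewrite (expand_det_row _ 0) sum3 /cofactor !det2 !mxE /=.
have -> : lift (0 : 'I_3) (0 : 'I_2) = 1 by apply: val_inj.
have -> : lift (0 : 'I_3) (1 : 'I_2) = 2 by apply: val_inj.
have -> : lift (1 : 'I_3) (0 : 'I_2) = 0 by apply: val_inj.
have -> : lift (1 : 'I_3) (1 : 'I_2) = 2 by apply: val_inj.
have -> : lift (2 : 'I_3) (0 : 'I_2) = 0 by apply: val_inj.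
have -> : lift (2 : 'I_3) (1 : 'I_2) = 1 by apply: val_inj.
rewrite /= addn0 add0n; ring.
Qed.

Definition unipotent n (g : 'M[C]_n) : Prop :=
  forall i j : 'I_n, (j <= i)%N -> g i j = (i == j)%:R.

Lemma unipotent_det n (g : 'M[C]_n) : unipotent g -> \det g = 1.
Proof.
move=> ug; rewrite -det_tr det_trig; last first.
  by apply/is_trig_mxP => i j lt_ij; rewrite mxE ug 1?ltnW // -val_eqE gtn_eqF.
by apply: big1 => i _; rewrite mxE ug ?eqxx.
Qed.

Lemma unipotent_unit n (g : 'M[C]_n) : unipotent g -> g \in unitmx.
Proof. by move=> ug; rewrite unitmxE unipotent_det ?unitr1. Qed.

(** These weights decrease strictly, so conjugation by the torus contracts upper unipotents to 1 as
    [u] tends to 0. They are also the exponents of the denominator in Jacobi's formula. *)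
Definition hgt (i : 'I_3) : nat := (2 - i)%N.

Section Contraction.
Variables (N : nat) (rho : 'M[C]_3 -> 'M[C]_N).
Hypotheses (rhoG : GLrep rho) (rhoP : polynomial_rep rho).
Variable A : 'M[{poly C}]_N.
Hypothesis rhoA : forall u, u != 0 -> rho (torus hgt u) = evmx u A.

(* [torus hgt u *m n *m (torus hgt u)^-1] is polynomial in [u] and equals 1 at [u = 0]. *)
Definition contraction (n : 'M[C]_3) : 'M[{poly C}]_3 :=
  \matrix_(i, j) (if (i <= j)%N then n i j *: 'X^(j - i) else 0).

Lemma unipotent_contraction n u : unipotent n -> unipotent (evmx u (contraction n)).
Proof.
move=> un i j le_ji; rewrite evmxE mxE; case: leqP => le_ij; last first.
  by rewrite horner0 -val_eqE gtn_eqF.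
have <- : j = i by apply: val_inj; apply/eqP; rewrite eqn_leq le_ji.
by rewrite subnn un // hornerZ hornerXn expr0 mulr1.
Qed.

Lemma contraction0 n : unipotent n -> evmx 0 (contraction n) = 1%:M.
Proof.
move=> un; apply/matrixP => i j; rewrite evmxE !mxE.
case: leqP => [|lt_ji]; last by rewrite horner0 -val_eqE gtn_eqF.
rewrite hornerZ hornerXn expr0n subn_eq0 leq_eqVlt val_eqE => /orP[/eqP->|lt_ij].
  by rewrite leqnn un // eqxx mulr1.
by rewrite leqNgt lt_ij mulr0 -val_eqE ltn_eqF.
Qed.

Lemma contraction_torus n u : unipotent n ->
  evmx u (contraction n) *m torus hgt u = torus hgt u *m n.
Proof.
move=> un; apply/matrixP => i j; rewrite mul_mx_diag mul_diag_mx !mxE /horner_eval.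
case: leqP => [le_ij|lt_ji]; last first.
  by rewrite horner0 mul0r un 1?ltnW // -val_eqE gtn_eqF ?mulr0.
rewrite hornerZ hornerXn -mulrA -exprD mulrC; congr (u ^+ _ * _).
by rewrite /hgt; have := ltn_ord j; lia.
Qed.

(** Read on coefficients, the component of [rho n] from degree [l] to degree [k] is zero for [k < l]
    and the identity for [k = l]: unipotents only add terms of higher degree. *)
Lemma rep_contraction_upper n : unipotent n ->
  exists2 E, coefmx 0 E = 1%:M & A *m map_mx polyC (rho n) = E *m A.
Proof.
move=> un; have [E eE] := rep_curve rhoP (contraction n).
have {}eE u : rho (evmx u (contraction n)) = evmx u E.
  by apply/eE/unipotent_unit/unipotent_contraction.
exists E.
  rewrite -(rep1 rhoG) -(contraction0 un) eE.
  by apply/matrixP => i j; rewrite !mxE /horner_eval horner_coef0.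
apply: evmx_eq => u u0; rewrite !evmxM evmx_polyC -rhoA // -eE.
by rewrite -!repM ?torus_unit ?contraction_torus ?unipotent_unit //; apply: unipotent_contraction.
Qed.

(** The counterpart for rows: acting on the right, [rho n^T] also only adds terms of higher
    degree. *)
Lemma rep_contraction_lower n : unipotent n ->
  exists2 E, coefmx 0 E = 1%:M & map_mx polyC (rho n^T) *m A = A *m E.
Proof.
move=> un; have [E eE] := rep_curve rhoP (contraction n)^T.
have evT u : evmx u (contraction n)^T = (evmx u (contraction n))^T by rewrite /evmx map_trmx.
have {}eE u : rho (evmx u (contraction n))^T = evmx u E.
  by rewrite -evT; apply: eE; rewrite evT unitmx_tr; exact/unipotent_unit/unipotent_contraction.
exists E.
  rewrite -(rep1 rhoG) -[1%:M in RHS]trmx1 -(contraction0 un) eE.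
  by apply/matrixP => i j; rewrite !mxE /horner_eval horner_coef0.
have tT u : (torus hgt u)^T = torus hgt u by rewrite tr_diag_mx.
apply: evmx_eq => u u0; rewrite !evmxM evmx_polyC -rhoA // -eE.
rewrite -!repM ?torus_unit ?unitmx_tr ?unipotent_unit //; last exact: unipotent_contraction.
by congr (rho _); apply: trmx_inj; rewrite !trmx_mul !trmxK tT contraction_torus.
Qed.

End Contraction.

End HighestWeight.

(** * Leading terms of the bialternant formula *)

Section Alternants.
Variable R : realType.
Local Notation C := R[i].

(** Jacobi's determinant at the point [(t_0 X^2, t_1 X, t_2)], that is, along a coset of the torus
    of weights [hgt]. *)
Definition alternant (t : 'I_3 -> C) (e : 'I_3 -> nat) : {poly C} :=
  \det (\matrix_(i, j) (t i *: 'X^(hgt i)) ^+ e j).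

(** For strictly decreasing exponents the identity permutation alone reaches the degree
    [2 e_0 + e_1]; [q] collects the other five. *)
Lemma alternant_lead (t : 'I_3 -> C) (e : 'I_3 -> nat) : (e 1%R < e 0%R)%N -> (e 2%R < e 1%R)%N ->
  exists2 q : {poly C}, (size q <= 2 * e 0%R + e 1%R)%N &
    alternant t e = (t 0 ^+ e 0 * t 1 ^+ e 1 * t 2 ^+ e 2) *: 'X^(2 * e 0%R + e 1%R) + q.
Proof.
move=> e01 e12; pose m c k : {poly C} := c *: 'X^k.
exists (- m (t 0 ^+ e 0%R * t 1 ^+ e 2%R * t 2 ^+ e 1%R) (2 * e 0%R + e 2%R)%N
        - m (t 0 ^+ e 1%R * t 1 ^+ e 0%R * t 2 ^+ e 2%R) (2 * e 1%R + e 0%R)%N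
        + m (t 0 ^+ e 1%R * t 1 ^+ e 2%R * t 2 ^+ e 0%R) (2 * e 1%R + e 2%R)%N
        + m (t 0 ^+ e 2%R * t 1 ^+ e 0%R * t 2 ^+ e 1%R) (2 * e 2%R + e 0%R)%N
        - m (t 0 ^+ e 2%R * t 1 ^+ e 1%R * t 2 ^+ e 0%R) (2 * e 2%R + e 1%R)%N).
  have sm c k : (k < 2 * e 0%R + e 1%R)%N -> (size (m c k) <= 2 * e 0%R + e 1%R)%N.
    by move=> lt_k; apply: leq_trans (size_scale_leq _ _) _; rewrite size_polyXn.
  have sD (p q : {poly C}) k : (size p <= k)%N -> (size q <= k)%N -> (size (p + q)%R <= k)%N.
    by move=> sp sq; apply: leq_trans (size_polyD _ _) _; rewrite geq_max sp.
  do 4![apply: (@sD); last by rewrite ?size_polyN; apply: (@sm); lia].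
  by rewrite size_polyN; apply: sm; lia.
rewrite /alternant det3 !mxE !exprZn -!exprM /m -!mul_polyC !exprD.
rewrite !(exprM, mulnC 2) /hgt /= !(subnn, subn0, expr0, expr1n).
rewrite !rmorphM /= !rmorphXn /=; ring.
Qed.

Lemma divided_lead (p V U q r : {poly C}) c d k n : c != 0 -> d != 0 ->
  V = c *: 'X^k + q -> (size q <= k)%N -> U = d *: 'X^(n + k) + r -> (size r <= n + k)%N ->
  p * V = U -> (size p <= n.+1)%N /\ p`_n = d / c.
Proof.
have lead (s q' : {poly C}) x l : x != 0 -> s = x *: 'X^l + q' -> (size q' <= l)%N ->
    size s = l.+1 /\ lead_coef s = x.
  move=> x0 -> sq; have sX : size (x *: 'X^l : {poly C}) = l.+1 by rewrite size_scale ?size_polyXn.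
  split; first by rewrite size_polyDl sX.
  by rewrite lead_coefDl ?sX // lead_coefZ lead_coefXn mulr1.
move=> c0 d0 eV sq eU sr pV.
have [sV lV] := lead _ _ _ _ c0 eV sq; have [sU lU] := lead _ _ _ _ d0 eU sr.
have V0 : V != 0 by rewrite -size_poly_eq0 sV.
have p0 : p != 0 by apply: contraTneq isT => p0; move: sU; rewrite -pV p0 mul0r size_poly0.
have sp : size p = n.+1.
  by move: sU; rewrite -pV size_mul // sV addnS /= => /eqP; rewrite -addSn eqn_add2r => /eqP.
split; first by rewrite sp.
apply: (mulIf c0); rewrite mulfVK // -lU -pV lead_coefM lV.
by rewrite lead_coefE sp.
Qed.

End Alternants.

(** * Highest weight vectors extracted from the character *)

Section HighestWeightPair.
Variable R : realType.
Local Notation C := R[i].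

(** The product [xi *m v] is the projection onto the highest weight line. Rows are moved from the
    right, so [v] is fixed by the lower unipotents where [xi] is fixed by the upper ones. *)
Record highest_weight_pair N (rho : 'M[C]_3 -> 'M[C]_N) (l1 l2 : nat)
    (v : 'rV[C]_N) (xi : 'cV[C]_N) : Prop := HighestWeightPair {
  hw_dual : v *m xi = 1%:M;
  hw_upper : forall n, unipotent n -> rho n *m xi = xi;
  hw_lower : forall n, unipotent n -> v *m rho n^T = v;
  hw_torusr : forall t : 'rV[C]_3, (forall i, t 0 i != 0) ->
    rho (diag_mx t) *m xi = (t 0 0 ^+ l1 * t 0 1 ^+ l2) *: xi;
  hw_torusl : forall t : 'rV[C]_3, (forall i, t 0 i != 0) ->
    v *m rho (diag_mx t) = (t 0 0 ^+ l1 * t 0 1 ^+ l2) *: v }.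

Lemma diag_unit (t : 'rV[C]_3) : (forall i, t 0 i != 0) -> diag_mx t \in unitmx.
Proof. by move=> t0; rewrite unitmxE det_diag unitfE; apply/prodf_neq0 => i _. Qed.

(** The trace of [P k *m rho (diag_mx t)] is the coefficient of [X^k] in the Schur polynomial at
    [(t_0 X^2, t_1 X, t_2)]. The leading term shows that [P top] has rank one and weight
    [(l1, l2, 0)], and that no degree lies above [top]; unipotents, which only add higher degrees,
    must fix it. *)
Lemma highest_weight_exists N (rho : 'M[C]_3 -> 'M[C]_N) l1 l2 : (l2 <= l1)%N ->
  schur_module (part3 l1 l2 0) rho -> exists v xi, highest_weight_pair rho l1 l2 v xi.
Proof.
move=> l21 [rhoG rhoP _ chi].
have [A [rhoA PP A1]] := torus_grading rhoG rhoP hgt.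
pose P k := coefmx k A; pose top := (2 * l1 + l2)%N.
have trP (t : 'rV[C]_3) : (forall i, t 0 i != 0) ->
    (forall k, (top < k)%N -> \tr (P k *m rho (diag_mx t)) = 0)
    /\ \tr (P top *m rho (diag_mx t)) = t 0 0 ^+ l1 * t 0 1 ^+ l2.
  move=> t0; set B := rho _; pose p : {poly C} := \tr (A *m map_mx polyC B).
  have cp k : p`_k = \tr (P k *m B).
    by rewrite -coefmx_mulr /p /mxtrace coef_sum; apply: eq_bigr => i _; rewrite coefmxE.
  pose e1 : 'I_3 -> nat := hgt; pose e2 (j : 'I_3) := (part3 l1 l2 0 j + hgt j)%N.
  have E : p * alternant (t 0) e1 = alternant (t 0) e2.
    apply: (@poly_eq_generic _ 'X); rewrite ?polyX_eq0 // => u; rewrite hornerX => u0.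
    have tu0 i : t 0 i * u ^+ hgt i != 0 by rewrite mulf_neq0 ?expf_neq0.
    have evalt e : (alternant (t 0) e).[u]
        = \det (\matrix_(i, j < 3) (t 0 i * u ^+ hgt i) ^+ e j).
      rewrite /alternant -det_evmx; congr (\det _); apply/matrixP => i j.
      by rewrite !mxE /horner_eval !hornerE.
    have := chi _ tu0; rewrite hornerM !evalt => <-; congr (_ * _).
    have -> : diag_mx (\row_i (t 0 i * u ^+ hgt i)) = torus hgt u *m diag_mx t.
      by rewrite mulmx_diag; congr diag_mx; apply/rowP => i; rewrite !mxE mulrC.
    rewrite repM ?torus_unit ?diag_unit // rhoA // -[rho (diag_mx t)](evmx_polyC u) -evmxM.
    by rewrite /p /mxtrace horner_sum; apply: eq_bigr => i _; rewrite evmxE.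
  have [q1 sq1 eq1] := @alternant_lead _ (t 0) e1 isT isT.
  have [q2 sq2 eq2] := @alternant_lead _ (t 0) e2
    ltac:(rewrite /e2 /part3 /hgt /=; lia) ltac:(rewrite /e2 /part3 /hgt /=; lia).
  have -> : t 0 0 ^+ l1 * t 0 1 ^+ l2 = (t 0 0 ^+ e2 0 * t 0 1 ^+ e2 1 * t 0 2 ^+ e2 2)
      / (t 0 0 ^+ e1 0 * t 0 1 ^+ e1 1 * t 0 2 ^+ e1 2).
    rewrite /e2 /e1 /part3 /hgt /= !subnn !subn0 !addn0 !expr0 !exprD.
    by field; rewrite !t0.
  have e2e1 : (2 * e2 0%R + e2 1%R = top + (2 * e1 0%R + e1 1%R))%N.
    by rewrite /e2 /e1 /top /part3 /hgt /=; lia.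
  rewrite e2e1 in eq2 sq2.
  have [] := divided_lead _ _ eq1 sq1 eq2 sq2 E; rewrite ?mulf_neq0 ?expf_neq0 //.
  move=> sp <-; split=> // k lt_k; rewrite -cp nth_default //; exact: leq_trans sp _.
have rankP k : \tr (P k) = (\rank (P k))%:R.
  by apply: idempotent_trace; rewrite PP eqxx.
have trP1 k : \tr (P k) = \tr (P k *m rho (diag_mx (const_mx 1))).
  by rewrite diag_const_mx (rep1 rhoG) mulmx1.
have one0 i : (const_mx 1 : 'rV[C]_3) 0 i != 0 by rewrite mxE oner_eq0.
have [trP0 trPt] := trP _ one0.
have P0 k : (top < k)%N -> P k = 0.
  by move=> /trP0; rewrite -trP1 rankP => /eqP; rewrite pnatr_eq0 mxrank_eq0 => /eqP.
have rk1 : \rank (P top) = 1%N.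
  apply/eqP; move: trPt; rewrite -trP1 rankP !mxE !expr1n mulr1 => /eqP.
  by rewrite pnatr_eq1.
have sumP : 1%:M = \sum_(k < top.+1) P k.
  rewrite -A1 (@evmx_sum _ _ _ _ top.+1) => [|k /P0 //].
  by apply: eq_bigr => k _; rewrite expr1n scale1r.
have [xi [v Pxv]] : exists xi : 'cV[C]_N, exists v : 'rV[C]_N, P top = xi *m v.
  move: (col_base _) (row_base _) (mulmx_base (P top)); rewrite rk1 => xi v <-.
  by exists xi, v.
have Pn0 : P top != 0 by rewrite -mxrank_eq0 rk1.
have vxi : v *m xi = 1%:M.
  have := PP top top; rewrite eqxx -/(P top) Pxv mulmxA -(mulmxA xi).
  rewrite (mx11_scalar (v *m xi)) mul_mx_scalar -scalemxAl -Pxv => /eqP.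
  rewrite -{2}[P top]scale1r -subr_eq0 -scalerBl scaler_eq0 (negPf Pn0) orbF.
  by rewrite subr_eq0 => /eqP->.
have cA := grading_mulr PP; have cA' := grading_mull PP.
have fixl n : unipotent n -> rho n *m P top = P top.
  move=> un; have [E E0 eE] := rep_contraction_upper rhoG rhoP rhoA un.
  have Pk k : P k *m rho n *m P top = if (k < top)%N then 0 else coefmx (k - top) E *m P top.
    rewrite -!coefmx_mulr eE -mulmxA cA -scalemxAr coefmxXn.
    by case: ifP => // _; rewrite coefmx_mulr.
  rewrite -[LHS]mul1mx sumP mulmx_suml big_ord_recr /= big1 => [|k _]; rewrite mulmxA Pk.
    by rewrite ltnn subnn E0 mul1mx add0r.
  by rewrite ltn_ord.
have fixr n : unipotent n -> P top *m rho n^T = P top.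
  move=> un; have [E E0 eE] := rep_contraction_lower rhoG rhoP rhoA un.
  have Pk k : P top *m rho n^T *m P k = if (k < top)%N then 0 else P top *m coefmx (k - top) E.
    rewrite -mulmxA -!coefmx_mull eE mulmxA cA' -scalemxAl coefmxXn.
    by case: ifP => // _; rewrite coefmx_mull.
  rewrite -[LHS]mulmx1 sumP mulmx_sumr big_ord_recr /= big1 => [|k _]; rewrite Pk.
    by rewrite ltnn subnn E0 mulmx1 add0r.
  by rewrite ltn_ord.
have commP (t : 'rV[C]_3) : (forall i, t 0 i != 0) -> rho (diag_mx t) *m P top = P top *m rho (diag_mx t).
  move=> t0; have E : map_mx polyC (rho (diag_mx t)) *m A = A *m map_mx polyC (rho (diag_mx t)).
    apply: evmx_eq => u u0; rewrite !evmxM !evmx_polyC -rhoA //.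
    rewrite -!repM ?torus_unit ?diag_unit // !mulmx_diag.
    by congr (rho (diag_mx _)); apply/rowP => i; rewrite !mxE mulrC.
  by rewrite -coefmx_mull E coefmx_mulr.
(* The compression of [B] to the highest weight line is a scalar, hence read off as a trace. *)
have trxv (B : 'M[C]_N) : v *m B *m xi = (\tr (P top *m B))%:M.
  by rewrite Pxv -(mulmxA xi) mxtrace_mulC trace_mx11 -mx11_scalar.
have Pxi : P top *m xi = xi by rewrite Pxv -mulmxA vxi mulmx1.
have vP : v *m P top = v by rewrite Pxv mulmxA vxi mul1mx.
exists v, xi; split=> //.
- by move=> n un; rewrite -{1}Pxi mulmxA fixl.
- by move=> n un; rewrite -{1}vP -mulmxA fixr.
- move=> t t0; rewrite -{1}Pxi mulmxA commP // Pxv -!mulmxA [v *m _]mulmxA trxv.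
  by have [_ ->] := trP _ t0; rewrite mul_mx_scalar.
move=> t t0; rewrite -{1}vP -mulmxA -commP // Pxv !mulmxA trxv.
by have [_ ->] := trP _ t0; rewrite mul_scalar_mx.
Qed.

End HighestWeightPair.

Section RowSubspaces.
Variable F : fieldType.

(** A matrix of maximal rank among those whose row space satisfies [P] must contain every vector
    satisfying [P]. Irreducibility, stated for matrices, thereby applies to predicates. *)
Lemma row_subspace N (P : 'rV[F]_N -> Prop) : P 0 ->
  (forall a u v, P u -> P v -> P (a *: u + v)) ->
  exists U : 'M[F]_N, forall v, P v <-> (v <= U)%MS.
Proof.
move=> P0 PD.
pose Q k := `[< exists2 U : 'M[F]_N, (forall v, (v <= U)%MS -> P v) & \rank U = k >].
have Q0 : exists k, Q k.
  by exists 0%N; apply/asboolP; exists 0; rewrite ?mxrank0 // => v; rewrite submx0 => /eqP->.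
have Qb k : Q k -> (k <= N)%N by move/asboolP => [U _ <-]; apply: rank_leq_row.
case: (ex_maxnP Q0 Qb) => k /asboolP[U UP rU] kmax.
exists U => v; split=> [Pv|]; last exact: UP.
apply: contraT => nvU; suff: (k < k)%N by rewrite ltnn.
apply: (@leq_trans (\rank (U + v)%MS)).
  rewrite -rU ltn_neqAle mxrankS ?addsmxSl // andbT.
  apply: contraNneq nvU => E; have := (mxrank_leqif_eq (addsmxSl U v)).2.
  by rewrite E eqxx => /esym/eqmxP->; apply: addsmxSr.
apply: kmax; apply/asboolP; exists (U + v)%MS => // w /sub_addsmxP[[a b]] /= ->.
rewrite addrC [b]mx11_scalar mul_scalar_mx; apply: PD => //.
by apply: UP; apply: submxMl.
Qed.

End RowSubspaces.

(** * Matrix coefficients, the big cell, and uses of irreducibility *)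

Section MatrixCoefficients.
Variable R : realType.
Local Notation C := R[i].

Definition minor2 (g : 'M[C]_3) : C := g 0 0 * g 1 1 - g 0 1 * g 1 0.

Definition mx3 (K : nmodType) (s : seq (seq K)) : 'M[K]_3 :=
  \matrix_(i, j) nth 0 (nth [::] s i) j.

(** Gaussian elimination, with pivots the quotients of successive leading minors. The factor [m]
    stays beside [g], because it will be absorbed by a highest weight column. *)
Lemma big_cell (g : 'M[C]_3) : g \in unitmx -> g 0 0 != 0 -> minor2 g != 0 ->
  exists l m, exists t : 'rV[C]_3, [/\ unipotent l, unipotent m,
    forall i, t 0 i != 0, g *m m = l^T *m diag_mx t &
    [/\ t 0 0 = g 0 0, t 0 1 = minor2 g / g 0 0 & m 0 1 = - g 0 1 / g 0 0]].
Proof.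
rewrite unitmxE unitfE => dg g0 d0.
pose l : 'M[C]_3 := mx3 [:: [:: 1; g 1 0 / g 0 0; g 2 0 / g 0 0];
  [:: 0; 1; (g 0 0 * g 2 1 - g 0 1 * g 2 0) / minor2 g]; [:: 0; 0; 1]].
pose m : 'M[C]_3 := mx3 [:: [:: 1; - g 0 1 / g 0 0; (g 0 1 * g 1 2 - g 0 2 * g 1 1) / minor2 g];
  [:: 0; 1; (g 0 2 * g 1 0 - g 0 0 * g 1 2) / minor2 g]; [:: 0; 0; 1]].
pose t : 'rV[C]_3 := \row_i nth 0 [:: g 0 0; minor2 g / g 0 0; \det g / minor2 g] i.
exists l, m, t; split; last by rewrite !mxE.
- by apply: ord3P; apply: ord3P => //= _; rewrite !mxE.
- by apply: ord3P; apply: ord3P => //= _; rewrite !mxE.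
- by apply: ord3P; rewrite mxE /= ?mulf_neq0 ?invr_neq0.
apply/matrixP; apply: ord3P; apply: ord3P; rewrite mul_mx_diag !mxE sum3 !mxE /= ?det3 /minor2;
  field; rewrite ?g0 ?d0 //.
Qed.

Section Irreducible.
Variables (N : nat) (rho : 'M[C]_3 -> 'M[C]_N) (l1 l2 : nat) (v : 'rV[C]_N) (xi : 'cV[C]_N).
Hypotheses (rhoG : GLrep rho) (rhoP : polynomial_rep rho).
Hypothesis hw : highest_weight_pair rho l1 l2 v xi.

Lemma polyfun_minor2 : polyfun minor2.
Proof.
apply: pf_add; first by apply: pf_mul; apply: pf_coord.
rewrite (_ : (fun g => _) = fun g : 'M[C]_3 => (-1) * (g 0 1 * g 1 0)).
  by apply: pf_mul; [exact: pf_const | apply: pf_mul; apply: pf_coord].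
by apply: funext => g; rewrite mulN1r.
Qed.

Lemma big_cell_dense f : regular f ->
  (forall g, g \in unitmx -> g 0 0 != 0 -> minor2 g != 0 -> f g = 0) ->
  forall g, g \in unitmx -> f g = 0.
Proof.
move=> rf f0; apply: (@regular_eq0 _ f (fun g => g 0 0 * minor2 g) rf).
- by apply: pf_mul; [exact: pf_coord | exact: polyfun_minor2].
- by rewrite /minor2 !mxE !mulr1n mulr0n mul0r subr0 !mul1r oner_eq0.
by move=> g ug; rewrite mulf_eq0 negb_or => /andP[]; apply: f0.
Qed.

(** On the big cell [xi] and [v] absorb the unipotent factors, and the torus contributes
    [g_00^l1 (minor2 g / g_00)^l2]; density does the rest. *)
Lemma matrix_coefficient g : (l2 <= l1)%N -> g \in unitmx ->
  v *m rho g *m xi = (g 0 0 ^+ (l1 - l2) * minor2 g ^+ l2)%:M.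
Proof.
move=> l21 ug; rewrite [LHS]mx11_scalar; congr (_%:M); apply/eqP; rewrite -subr_eq0; apply/eqP.
move: g ug; apply: big_cell_dense => [|g ug g0 d0].
  apply: (@eq_regular _ (fun g => (v *m rho g *m xi) 0 0 + (-1) * (g 0 0 ^+ (l1 - l2) * minor2 g ^+ l2))).
    by move=> g _; rewrite mulN1r.
  apply: regularD; first exact: rep_coef_regular.
  apply: regularM; first exact: regular_const.
  by apply: regularM; apply: regularX; apply: polyfun_regular; [exact: pf_coord | exact: polyfun_minor2].
have [l [m [t [ul um t0 gm [t0E t1E _]]]]] := big_cell ug g0 d0.
have [um' ul'] := (unipotent_unit um, unipotent_unit ul).
rewrite -{1}(hw_upper hw um) mulmxA -(mulmxA v) -repM // gm.
rewrite repM ?unitmx_tr ?diag_unit // mulmxA (hw_lower hw) // (hw_torusl hw) //.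
rewrite -scalemxAl (hw_dual hw) !mxE mulr1 t0E t1E.
have -> : g 0 0 ^+ l1 = g 0 0 ^+ (l1 - l2) * g 0 0 ^+ l2 by rewrite -exprD subnK.
by rewrite expr_div_n; field; rewrite expf_neq0.
Qed.

Hypothesis rhoI : irreducible_rep rho.

Lemma hw_row_neq0 : v != 0.
Proof.
apply: contraTneq isT => v0; have := hw_dual hw; rewrite v0 mul0mx.
by move/matrixP/(_ 0 0); rewrite !mxE mulr1n => /esym/eqP; rewrite oner_eq0.
Qed.

Lemma invariant_row_subspace (P : 'rV[C]_N -> Prop) : P 0 ->
  (forall a u w, P u -> P w -> P (a *: u + w)) ->
  (forall g u, g \in unitmx -> P u -> P (u *m rho g)) ->
  (forall u, P u -> u = 0) \/ (forall u, P u).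
Proof.
move=> P0 PD Pg; have [U PU] := row_subspace P0 PD.
have [_ /(_ _ U)[]] := rhoI.
- move=> g ug; apply/row_subP => i; rewrite row_mul -PU; apply: Pg => //.
  by rewrite PU row_sub.
- by move/eqP=> U0; left=> u; rewrite PU U0 submx0 => /eqP.
by move=> fU; right=> u; rewrite PU submx_full.
Qed.

(** The rows that annihilate the orbit of [xi] form an invariant subspace, which omits [v]. *)
Lemma row_eq0_orbit (z : 'rV[C]_N) :
  (forall g, g \in unitmx -> z *m rho g *m xi = 0) -> z = 0.
Proof.
move: z; case: (@invariant_row_subspace (fun z => forall g, g \in unitmx -> z *m rho g *m xi = 0)).
- by move=> g _; rewrite !mul0mx.
- by move=> a u w hu hw' g ug; rewrite !mulmxDl -!scalemxAl hu // hw' // scaler0 addr0.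
- by move=> g u ug hu h uh; rewrite -(mulmxA u) -repM // hu // unitmx_mul ug.
- by [].
move/(_ v _ (unitmx1 _ _)); rewrite (rep1 rhoG) mulmx1 (hw_dual hw).
by move/matrixP/(_ 0 0); rewrite !mxE mulr1n => /eqP; rewrite oner_eq0.
Qed.

(** Irreducibility speaks of rows, so it is applied to the double annihilator of the orbit of [v]:
    it contains [v], hence every row, and unit rows read off the entries of [w]. *)
Lemma col_eq0_orbit (w : 'cV[C]_N) :
  (forall g, g \in unitmx -> v *m rho g *m w = 0) -> w = 0.
Proof.
move=> w0.
case: (@invariant_row_subspace (fun z => forall y : 'cV_N,
   (forall g, g \in unitmx -> v *m rho g *m y = 0) -> z *m y = 0)).
- by move=> y _; rewrite mul0mx.
- by move=> a u z hu hz y hy; rewrite mulmxDl -scalemxAl hu // hz // scaler0 addr0.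
- move=> g u ug hu y hy; rewrite -mulmxA; apply: hu => h uh.
  by rewrite mulmxA -(mulmxA v) -repM // hy // unitmx_mul uh.
- move=> /(_ v) H; case/eqP: hw_row_neq0; apply: H => y hy.
  by rewrite -(hy _ (unitmx1 _ _)) (rep1 rhoG) mulmx1.
move=> H; apply/matrixP => i j.
have /matrixP/(_ 0 j) := H (delta_mx 0 i) w w0.
by rewrite -rowE !mxE.
Qed.

(** Let [U] be the row space of the transposed span. A column killed by [U] is, transposed, a row
    annihilating the orbit of [xi], hence zero; so [U] is full. *)
Lemma orbit_span (eta : 'cV[C]_N) : exists2 s : seq (C * 'M[C]_3),
  all (fun x => x.2 \in unitmx) s & eta = \sum_(x <- s) x.1 *: (rho x.2 *m xi).
Proof.
pose P (z : 'rV[C]_N) := exists2 s : seq (C * 'M[C]_3),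
  all (fun x => x.2 \in unitmx) s & z^T = \sum_(x <- s) x.1 *: (rho x.2 *m xi).
have P0 : P 0 by exists [::]; rewrite // big_nil trmx0.
have PD a u w : P u -> P w -> P (a *: u + w).
  move=> [s us su] [s' us' sw]; exists ([seq (a * x.1, x.2) | x <- s] ++ s').
    by rewrite all_cat us' andbT all_map.
  rewrite big_cat big_map /= -sw linearD linearZ /= su scaler_sumr; congr (_ + _).
  by apply: eq_bigr => x _; rewrite scalerA.
have [U PU] := row_subspace P0 PD.
suff fU : row_full U by have [] := (PU eta^T).2 (submx_full _ fU); rewrite trmxK => s; exists s.
have kU : forall z : 'cV[C]_N, U *m z = 0 -> z = 0.
  move=> z Uz; apply: trmx_inj; rewrite trmx0; apply: row_eq0_orbit => g ug.
  apply: trmx_inj; rewrite trmx0 !trmx_mul trmxK mulmxA -trmx_mul.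
  have /PU/submxP[D ->] : P (rho g *m xi)^T; last by rewrite -mulmxA Uz mulmx0.
  by exists [:: (1, g)]; rewrite /= ?ug // big_seq1 trmxK scale1r.
rewrite -cokermx_eq0; apply/eqP/matrixP => i j.
have /matrixP/(_ i 0) : col j (cokermx U) = 0 by apply: kU; rewrite !colE mulmxA mulmx_coker mul0mx.
by rewrite !mxE.
Qed.

End Irreducible.

End MatrixCoefficients.

(** * The invariant tensor *)

Section InvariantTensor.
Variable R : realType.
Local Notation C := R[i].

Record invariant_data (a b Nmu Nnu : nat)
    (rmu : 'M[C]_3 -> 'M[C]_Nmu) (rnu : 'M[C]_3 -> 'M[C]_Nnu)
    (vmu : 'rV[C]_Nmu) (xmu : 'cV[C]_Nmu) (vnu : 'rV[C]_Nnu) (xnu : 'cV[C]_Nnu)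
    (T : 'I_3 -> 'M[C]_(Nmu, Nnu)) : Prop := InvariantData {
  muG : GLrep rmu; muP : polynomial_rep rmu; muI : irreducible_rep rmu;
  muW : highest_weight_pair rmu (a + b + 1) a vmu xmu;
  nuG : GLrep rnu; nuP : polynomial_rep rnu; nuI : irreducible_rep rnu;
  nuW : highest_weight_pair rnu (a + b + 1) (a + 1) vnu xnu;
  inv_tensor : forall g, g \in unitmx -> forall i,
    \sum_i' g i i' *: (rmu g *m T i') = T i *m rnu g;
  inv_neq0 : exists i, T i != 0 }.

Variables (a b Nmu Nnu : nat).
Variables (rmu : 'M[C]_3 -> 'M[C]_Nmu) (rnu : 'M[C]_3 -> 'M[C]_Nnu).
Variables (vmu : 'rV[C]_Nmu) (xmu : 'cV[C]_Nmu) (vnu : 'rV[C]_Nnu) (xnu : 'cV[C]_Nnu).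
Variable T : 'I_3 -> 'M[C]_(Nmu, Nnu).
Hypothesis D : invariant_data a b rmu rnu vmu xmu vnu xnu T.

(** This is [g_00] times the entry [(i, 1)] of the unipotent factor [m] of [g] in [big_cell]. *)
Definition extremal (g : 'M[C]_3) (i : 'I_3) : C := nth 0 [:: - g 0 1; g 0 0; 0] i.

(** The weights of [vmu] and [xnu] differ by the weight of the coordinate 1 of V. *)
Lemma lead_row_tensor (i : 'I_3) : i != 1 -> vmu *m T i *m xnu = 0.
Proof.
(* The entries 1, 2, 4 suffice to tell the three coordinate weights apart. *)
move=> i1; pose t : 'rV[C]_3 := \row_j 2%:R ^+ j.
have t0 j : t 0 j != 0 by rewrite mxE expf_neq0 // pnatr_eq0.
have := inv_tensor D (diag_unit t0) i.
rewrite (bigD1 i) //= big1 => [|j ij]; last by rewrite mxE eq_sym (negPf ij) scale0r.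
rewrite addr0 mxE eqxx mulr1n => /(congr1 (fun M => vmu *m M *m xnu)).
rewrite -scalemxAr -!scalemxAl !mulmxA (hw_torusl (muW D)) // -!scalemxAl.
rewrite -!mulmxA (hw_torusr (nuW D)) // -!scalemxAr !mulmxA scalerA => /eqP.
rewrite -subr_eq0 -scalerBl scaler_eq0 => /orP[|/eqP//].
rewrite !mxE /= expr0 !expr1n !mul1r expr1 -exprD -!natrX subr_eq0 eqr_nat eqn_exp2l //.
by move: i i1 {t0}; apply: ord3P => //= _; lia.
Qed.

(** On the big cell, moving [m] across the slice produces row [i] of [m], of which only the entry at
    1 pairs [vmu] with [xnu]. *)
Lemma extremal_coefficient : exists2 c : C, c != 0 & forall g, g \in unitmx -> forall i,
  vmu *m rmu g *m T i *m xnu = (c * (g 0 0 ^+ b * minor2 g ^+ a * extremal g i))%:M.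
Proof.
pose c : C := (vmu *m T 1 *m xnu) 0 0; 
have formula g : g \in unitmx -> forall i,
    vmu *m rmu g *m T i *m xnu = (c * (g 0 0 ^+ b * minor2 g ^+ a * extremal g i))%:M.
  move=> ug i; rewrite [LHS]mx11_scalar; congr (_%:M); apply/eqP; rewrite -subr_eq0; apply/eqP.
  move: g ug; apply: big_cell_dense => [|g ug g0 d0].
    apply: (@eq_regular _ (fun g => (vmu *m rmu g *m (T i *m xnu)) 0 0 +
       (- c) * (g 0 0 ^+ b * minor2 g ^+ a * extremal g i))).
      by move=> g _; rewrite mulNr mulmxA.
    apply: regularD; first exact: (rep_coef_regular (muP D) vmu (T i *m xnu) 0 0).
    apply: regularM; first exact: regular_const.
    apply: regularM; first apply: regularM; try apply: regularX.
    - exact/polyfun_regular/pf_coord.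
    - exact/polyfun_regular/polyfun_minor2.
    move: i; apply: ord3P; rewrite /extremal /=.
    - apply: (@eq_regular _ (fun g => (-1) * g 0 1)); first by move=> g _; rewrite mulN1r.
      by apply: regularM; [exact: regular_const | exact/polyfun_regular/pf_coord].
    - exact/polyfun_regular/pf_coord.
    - exact: regular_const.
  have [l [m [t [ul um t0 gm [t0E t1E m01]]]]] := big_cell ug g0 d0.
  have [um' ul'] := (unipotent_unit um, unipotent_unit ul).
  have -> : vmu *m rmu g *m T i *m xnu = vmu *m rmu g *m rmu m *m (\sum_i' m i i' *: T i') *m xnu.
    rewrite -[in LHS](hw_upper (nuW D) um) !mulmxA -[_ *m T i *m _]mulmxA -(inv_tensor D) //.
    rewrite !mulmx_sumr; congr (_ *m _); apply: eq_bigr => i' _.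
    by rewrite -!scalemxAr !mulmxA.
  rewrite -(mulmxA vmu) -(repM (muG D)) // gm (repM (muG D)) ?unitmx_tr ?diag_unit //.
  rewrite mulmxA (hw_lower (muW D)) // (hw_torusl (muW D)) // -!scalemxAl.
  have -> : vmu *m (\sum_i' m i i' *: T i') *m xnu = (m i 1 * c)%:M.
    rewrite mulmx_sumr mulmx_suml (bigD1 1) //= big1 => [|j j1]; last first.
      by rewrite -scalemxAr -scalemxAl lead_row_tensor // scaler0.
    by rewrite addr0 -scalemxAr -scalemxAl [vmu *m _ *m _]mx11_scalar scale_scalar_mx.
  rewrite !mxE mulr1n t0E t1E.
  have -> : m i 1 = extremal g i / g 0 0.
    by move: i; apply: ord3P; rewrite /extremal /= ?m01 // um // ?divff ?mul0r.
  by rewrite -addnA exprD addn1 exprS expr_div_n; field; rewrite ?expf_neq0 ?g0.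
(* If [c = 0], every [T j *m xnu] vanishes, and by invariance each row of each slice annihilates the
   orbit of [xnu]. *)
exists c => //; apply/eqP => c0; have [i /eqP[]] := inv_neq0 D.
have Tx0 j : T j *m xnu = 0.
  apply: (col_eq0_orbit (muG D) (muW D) (muI D)) => g ug.
  by rewrite mulmxA formula // c0 mul0r -scalemx1 scale0r.
apply/row_matrixP => k; rewrite row0.
apply: (row_eq0_orbit (nuG D) (nuW D) (nuI D)) => g ug.
rewrite -!row_mul -(inv_tensor D) // mulmx_suml big1 ?row0 // => j _.
by rewrite -scalemxAl -mulmxA Tx0 mulmx0 scaler0.
Qed.

End InvariantTensor.

(** * The differential equation on the chart *)

(* On [[X, 1, M], [-1, 0, K], [0, 0, 1]] the highest weight functions are spanned by
   [s ^+ b * t ^+ a.+1] with [s] and [t] the linear forms below. There [flow] is the action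
   of [E_01], and [opL] is [- a.+1] times [(b + 1) T_1 + T_0 E_01]. *)
Section ChartOperator.
Variables (A : comNzRingType) (dK dM dX : A -> A) (K M X : A) (a b : nat).

(** Right multiplication by [1 + u E_01] leaves the chart. Renormalising the rows sends [X], [M],
    [K] to [X / (1 + u X)], [M / (1 + u X)], [K + u (M + X K)] with multiplier [(1 + u X)^b]; this
    is the derivative at [u = 0]. *)
Definition flow (f : A) : A :=
  X * (f *+ b - X * dX f - M * dM f + K * dK f) + M * dK f.

(** On [s^b t^(a+1)], and up to the common factor [-(a+1)] and the scale of T, the slice [T_0] is
    [(a+1) f - K dK f] and [T_1] is [X (K dK f - (a+1) f) + M dK f]. *)
Definition opL (f : A) : A :=
  flow f *+ a.+1 - K * dK (flow f) + (X * (K * dK f - f *+ a.+1) + M * dK f) *+ b.+1.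

Definition derivation (d : A -> A) : Prop :=
  {morph d : x y / x + y} /\ forall x y, d (x * y) = d x * y + x * d y.

Lemma derivationX d x n : derivation d -> d (x ^+ n.+1) = (x ^+ n * d x) *+ n.+1.
Proof.
move=> [dD dM']; elim: n => [|n IHn]; first by rewrite expr0 expr1 mul1r.
by rewrite exprS dM' IHn mulrnAr mulrA -exprS [in LHS]mulrC [RHS]mulrS.
Qed.

Lemma derivation1 d : derivation d -> d 1 = 0.
Proof.
move=> [_ dM']; have /eqP := dM' 1 1; rewrite !mulr1 mul1r -[X in X == _]addr0.
by rewrite (can_eq (addKr _)) => /eqP.
Qed.

Lemma derivationN d x : derivation d -> d (- x) = - d x.
Proof.
move=> [dD _]; have d0 : d 0 = 0 by apply: (addrI (d 0)); rewrite -dD !addr0.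
by apply/eqP; rewrite -subr_eq0 opprK -dD addNr d0.
Qed.

Hypotheses (derK : derivation dK) (derM : derivation dM) (derX : derivation dX).
Variables s t p0 p1 p2 q0 q1 q2 : A.
Hypotheses (sE : s = X * p0 + p1 + M * p2) (tE : t = K * q0 - (M + X * K) * q1 + q2).
Hypotheses (dKs : dK s = 0) (dMs : dM s = p2) (dXs : dX s = p0).
Hypotheses (dKt : dK t = q0 - X * q1) (dMt : dM t = - q1) (dXt : dX t = - (K * q1)).
Hypotheses (dKX : dK X = 0) (dKM : dK M = 0) (dKK : dK K = 1).
Hypotheses (dKp1 : dK p1 = 0) (dKq0 : dK q0 = 0).

Lemma opL_linear_forms : opL (s ^+ b * t ^+ a.+1) =
  - ((s ^+ b * t ^+ a * (X * q2 - M * q0)) *+ b.+1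
     + (s ^+ b.-1 * X * p1 * t ^+ a * (M * q1 - q2)) *+ b
     + (s ^+ b * t ^+ a.-1 * (M + X * K) * q0 * (M * q1 - q2)) *+ a
     - s ^+ b * t ^+ a * M * q0) *+ a.+1.
Proof.
(* At [n = 0] the truncated exponent is harmless, being multiplied by 0. *)
have dpow d x n : derivation d -> d (x ^+ n) = (x ^+ n.-1 * d x) *+ n.
  by move=> dd; case: n => [|n]; rewrite ?derivationX //= expr0 derivation1.
have df d : derivation d -> d (s ^+ b * t ^+ a.+1)
    = (s ^+ b.-1 * d s * t ^+ a.+1) *+ b + (s ^+ b * t ^+ a * d t) *+ a.+1.
  by move=> dd; rewrite (dd.2) (dpow d s) // (dpow d t) // mulrnAl mulrnAr mulrA.
have fE : flow (s ^+ b * t ^+ a.+1) = (s ^+ b.-1 * X * p1 * t ^+ a.+1) *+ b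
     + (s ^+ b * t ^+ a * (M + X * K) * q0) *+ a.+1.
  rewrite /flow !df // dKs dMs dXs dKt dMt dXt.
  rewrite [t ^+ a.+1]exprS; move: (t ^+ a) => T0; case: b => [|n] /=.
    by rewrite expr0; ring: tE.
  rewrite exprS; move: (s ^+ n) => S1; rewrite sE tE; ring.
have dN x y : dK x = 0 -> dK (x * y) = x * dK y by move=> x0; rewrite derK.2 x0 mul0r add0r.
have dMn x n : dK (x *+ n) = dK x *+ n.
  elim: n => [|n IHn]; last by rewrite !mulrS derK.1 IHn.
  by rewrite !mulr0n; apply: (addrI (dK 0)); rewrite -derK.1 !addr0.
have dsb n : dK (s ^+ n) = 0 by rewrite dpow // dKs mulr0 mul0rn.
have dKf : dK (flow (s ^+ b * t ^+ a.+1)) =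
    (s ^+ b.-1 * X * p1 * ((t ^+ a * (q0 - X * q1)) *+ a.+1)) *+ b
  + (s ^+ b * q0 * (X * t ^+ a + (M + X * K) * (t ^+ a.-1 * (q0 - X * q1)) *+ a)) *+ a.+1.
  rewrite fE derK.1 !dMn; congr (_ *+ _ + _ *+ _).
    by rewrite dN ?(dpow dK t) ?dKt // !derK.2 dsb dKX dKp1 !(mul0r, mulr0, addr0).
  rewrite !(derK.2, derK.1) dsb dKM dKX dKK (dpow dK t) // dKt dKq0.
  move: (s ^+ b) (t ^+ a) (t ^+ a.-1) => S0 T0 T1; ring.
rewrite /opL dKf fE !df // dKs dKt; move: (s ^+ b) (s ^+ b.-1) => S0 S1.
case: {dKf fE df}a => [|n] /=; first by rewrite expr0 expr1; ring: tE.
by rewrite [t ^+ n.+2]exprS [t ^+ n.+1]exprS; move: (t ^+ n) => T1; ring: tE.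
Qed.

End ChartOperator.

(** * Polynomials in the three chart coordinates *)

Section ChartPolynomials.
Variable F : numFieldType.
Local Notation poly3 := {poly {poly {poly F}}}.

Lemma poly_eq0_nat (A : idomainType) (p : {poly A}) :
  injective (fun n => n%:R : A) -> (forall n, p.[n%:R] = 0) -> p = 0.
Proof.
move=> natI p0; apply/eqP; apply: contraT => pn0.
have := @max_poly_roots _ p [seq i%:R | i <- iota 0 (size p)] pn0.
rewrite size_map size_iota ltnn; move=> ->//.
  by apply/allP => _ /mapP[i _ ->]; apply/rootP.
by rewrite map_inj_uniq ?iota_uniq.
Qed.

Lemma natI0 : injective (fun n => n%:R : F).
Proof. by move=> i j /eqP; rewrite eqr_nat => /eqP. Qed.

Lemma natI1 (A : nzRingType) :
  injective (fun n => n%:R : A) -> injective (fun n => n%:R : {poly A}).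
Proof. by move=> natI i j; rewrite -!polyC_natr => /polyC_inj /natI. Qed.

Lemma eval2_eq0 (f : {poly {poly F}}) : (forall k x, f.[k%:P].[x] = 0) -> f = 0.
Proof.
move=> f0; apply: poly_eq0_nat => [|k]; first exact/natI1/natI0.
by apply: poly_eq0_nat => [|x]; [exact: natI0 | rewrite -polyC_natr f0].
Qed.

(** The variables are nested with [K] outermost, [M] in the middle and [X] innermost. *)
Definition eval3 (f : poly3) (k m x : F) : F := f.[k%:P%:P].[m%:P].[x].

Lemma eval3_eq0 (f : poly3) : (forall k m x, eval3 f k m x = 0) -> f = 0.
Proof.
move=> f0; apply: poly_eq0_nat => [|k]; first exact/natI1/natI1/natI0.
by apply: eval2_eq0 => m x; rewrite -[k%:R]polyC_natr -polyC_natr; apply: f0.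
Qed.

(** At fixed [k] and [x] the values determine the polynomial in [M], so its coefficients from [d] on
    vanish there; as functions of [k] and [x] they are then zero. *)
Lemma coef_eq0_slice (f : poly3) d :
  (forall k x, exists2 p : {poly F}, (size p <= d)%N & forall m, eval3 f k m x = p.[m]) ->
  forall k l, (d <= l)%N -> f`_k`_l = 0.
Proof.
move=> fp k l le_dl; rewrite -[LHS]/(coefp l f`_k) -coef_map /=.
suff -> : map_poly (coefp l) f = 0 by rewrite coef0.
apply: eval2_eq0 => {}k x.
have -> : (map_poly (coefp l) f).[k%:P] = f.[k%:P%:P]`_l.
  rewrite (@horner_coef_wide _ (size f) (map_poly _ f)) ?size_poly // horner_coef coef_sum.
  apply: eq_bigr => i _; rewrite coef_map /= -!rmorphXn /= coefMC //.
have [p sp fE] := fp k x.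
rewrite -/(horner_eval x _) -coef_map.
suff -> : map_poly (horner_eval x) f.[k%:P%:P] = p by apply: nth_default (leq_trans sp le_dl).
apply: poly_eq_horner => m; rewrite -fE /eval3.
rewrite -[m in LHS](hornerC m x) -/(horner_eval x m%:P) horner_map //.
Qed.

Definition dK3 (f : poly3) : poly3 := f^`().
Definition dM3 (f : poly3) : poly3 := map_poly (@deriv _) f.
Definition dX3 (f : poly3) : poly3 := map_poly (map_poly (@deriv _)) f.

Lemma map_derivation (A : comNzRingType) (d : {additive A -> A}) :
  derivation d -> derivation (map_poly d).
Proof.
move=> [dD dM']; split=> [x y|x y]; first exact: raddfD.
apply/polyP => i; rewrite coefD !coefM coef_map /= coefM raddf_sum -big_split /=.
by apply: eq_bigr => j _; rewrite dM' !coef_map.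
Qed.

Lemma deriv_derivation (A : comNzRingType) : derivation (@deriv A).
Proof. by split=> x y; rewrite ?derivD ?derivM. Qed.

Lemma dK3_derivation : derivation dK3. Proof. exact: deriv_derivation. Qed.
Lemma dM3_derivation : derivation dM3.
Proof. exact/map_derivation/deriv_derivation. Qed.
Lemma dX3_derivation : derivation dX3.
Proof. exact/map_derivation/map_derivation/deriv_derivation. Qed.

End ChartPolynomials.

(** The value of [(b + 1) T_1 + T_0 E_01] on one translate [s^b t^(a+1)] of the highest weight
    function, up to the scale of T. *)
Definition orbit_expr (A : comNzRingType) a b (s t X M K p1 q0 q1 q2 : A) : A :=
  (s ^+ b * t ^+ a * (X * q2 - M * q0)) *+ b.+1
     + (s ^+ b.-1 * X * p1 * t ^+ a * (M * q1 - q2)) *+ b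
     + (s ^+ b * t ^+ a.-1 * (M + X * K) * q0 * (M * q1 - q2)) *+ a
     - s ^+ b * t ^+ a * M * q0.

Lemma rmorph_orbit_expr (A B : comNzRingType) (f : {rmorphism A -> B}) a b s t X M K p1 q0 q1 q2 :
  f (orbit_expr a b s t X M K p1 q0 q1 q2) =
  orbit_expr a b (f s) (f t) (f X) (f M) (f K) (f p1) (f q0) (f q1) (f q2).
Proof. by rewrite /orbit_expr !(rmorphMn, rmorphN, rmorphD, rmorphM, rmorphXn). Qed.

Section ConstantForms.
Variables (A : comNzRingType) (dK dM dX : A -> A) (K M X : A) (a b : nat).
Hypotheses (sK : derivation dK) (sM : derivation dM) (sX : derivation dX).
Hypotheses (dKK : dK K = 1) (dKM : dK M = 0) (dKX : dK X = 0).
Hypotheses (dMK : dM K = 0) (dMM : dM M = 1) (dMX : dM X = 0).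
Hypotheses (dXK : dX K = 0) (dXM : dX M = 0) (dXX : dX X = 1).
Lemma opL_linear c x y : dK c = 0 -> dM c = 0 -> dX c = 0 ->
  opL dK dM dX K M X a b (c * x + y) = c * opL dK dM dX K M X a b x + opL dK dM dX K M X a b y.
Proof.
move=> Kc Mc Xc.
have lin d : derivation d -> d c = 0 -> forall z w, d (c * z + w) = c * d z + d w.
  by move=> [dD dMul] dc z w; rewrite dD dMul dc mul0r add0r.
have fE : flow dK dM dX K M X b (c * x + y) =
    c * flow dK dM dX K M X b x + flow dK dM dX K M X b y.
  by rewrite /flow (lin dK) // (lin dM) // (lin dX) //; ring.
by rewrite /opL fE (lin dK) // (lin dK) //; ring.
Qed.

Variables p0 p1 p2 q0 q1 q2 : A.
Let cst x := [/\ dK x = 0, dM x = 0 & dX x = 0].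
Hypotheses (cp0 : cst p0) (cp1 : cst p1) (cp2 : cst p2).
Hypotheses (cq0 : cst q0) (cq1 : cst q1) (cq2 : cst q2).

Lemma opL_linear_forms_const (s := X * p0 + p1 + M * p2)
    (t := K * q0 - (M + X * K) * q1 + q2) :
  opL dK dM dX K M X a b (s ^+ b * t ^+ a.+1) =
  - orbit_expr a b s t X M K p1 q0 q1 q2 *+ a.+1.
Proof.
case: cp0 cp1 cp2 cq0 cq1 cq2 =>
  [Kp0 Mp0 Xp0] [Kp1 Mp1 Xp1] [Kp2 Mp2 Xp2] [Kq0 Mq0 Xq0] [Kq1 Mq1 Xq1] [Kq2 Mq2 Xq2].
have eK x := derivationN x sK; have eM x := derivationN x sM; have eX x := derivationN x sX.
have iK := (sK.1, sK.2, eK, dKK, dKM, dKX, Kp0, Kp1, Kp2, Kq0, Kq1, Kq2).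
have iM := (sM.1, sM.2, eM, dMK, dMM, dMX, Mp0, Mp1, Mp2, Mq0, Mq1, Mq2).
have iX := (sX.1, sX.2, eX, dXK, dXM, dXX, Xp0, Xp1, Xp2, Xq0, Xq1, Xq2).
by apply: (@opL_linear_forms _ _ _ _ _ _ _ a b sK sM sX s t p0 p1 p2 q0 q1 q2) => //;
  rewrite /s /t ?iK ?iM ?iX; ring.
Qed.

End ConstantForms.

(** * The coefficient recursion *)

Section ChartRecursion.
Variable F : numFieldType.
Local Notation poly3 := {poly {poly {poly F}}}.

Definition K3 : poly3 := 'X.
Definition M3 : poly3 := 'X%:P.
Definition X3 : poly3 := 'X%:P%:P.
Definition const3 (c : F) : poly3 := c%:P%:P%:P.

Definition opL3 a b : poly3 -> poly3 := opL (@dK3 F) (@dM3 F) (@dX3 F) K3 M3 X3 a b.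

Definition coef3 (k l i : nat) (f : poly3) : F := f`_k`_l`_i.

Lemma coef3_X k l i (f : poly3) :
  coef3 k l i (X3 * f) = if i is i'.+1 then coef3 k l i' f else 0.
Proof. by rewrite /coef3 !coefCM coefXM; case: i. Qed.

Lemma coef3_KdK k l i (f : poly3) : coef3 k l i (K3 * dK3 f) = coef3 k l i f *+ k.
Proof. by rewrite /coef3 coefXM coef_deriv; case: k => [|k]; rewrite ?coef0 //= !coefMn. Qed.

Lemma coef3_MdM k l i (f : poly3) : coef3 k l i (M3 * dM3 f) = coef3 k l i f *+ l.
Proof.
rewrite /coef3 coefCM coef_map /= coefXM coef_deriv.
by case: l => [|l]; rewrite ?coef0 //= !coefMn.
Qed.

Lemma coef3_XdX k l i (f : poly3) : coef3 k l i (X3 * dX3 f) = coef3 k l i f *+ i.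
Proof.
by rewrite coef3_X /coef3 !coef_map /=; case: i => [|i]; rewrite ?coef_deriv.
Qed.

Lemma coef3_MdK k l i (f : poly3) : coef3 k l i (M3 * dK3 f) =
  if l is l'.+1 then coef3 k.+1 l' i f *+ k.+1 else 0.
Proof.
rewrite /coef3 coefCM coefXM coef_deriv.
by case: l => [|l] /=; rewrite ?coef0 // !coefMn.
Qed.

(** Euler operators act diagonally, so only two coefficients are linked, [(k, l, i - 1)] and
    [(k + 1, l - 1, i)]. The recursion thus splits into chains with constant [k + l] and [i - k]. *)
Lemma coef3_opL3 a b (f : poly3) k l i : coef3 k l i (opL3 a b f) =
  (if i is i'.+1 then (a.+1%:R - k%:R) * (k%:R - i'%:R - l%:R - 1) * coef3 k l i' f else 0)
  + (if l is l'.+1 then k.+1%:R * (a%:R + b%:R + 2%:R - k%:R) * coef3 k.+1 l' i f else 0).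
Proof.
have cE (x y : poly3) k' l' i' : coef3 k' l' i' (x + y) = coef3 k' l' i' x + coef3 k' l' i' y.
  by rewrite /coef3 !coefD.
have cN (x : poly3) k' l' i' : coef3 k' l' i' (- x) = - coef3 k' l' i' x.
  by rewrite /coef3 !coefN.
have cn (x : poly3) n k' l' i' : coef3 k' l' i' (x *+ n) = coef3 k' l' i' x *+ n.
  by rewrite /coef3 !coefMn.
rewrite /opL3 /opL /flow cE cn cE cN cn coef3_KdK !cE !coef3_X !coef3_MdK.
case: i => [|i]; first by case: l => [|l]; ring.
rewrite !(cE, cN, cn) !coef3_XdX !coef3_MdM !coef3_KdK; case: l => [|l]; ring.
Qed.

(** If [k + l > a], the chain begins with a zero, by the bound on [l] or because [i] would be
    negative; zeros propagate to larger [k], as [(k + 1)(a + b + 2 - k)] is nonzero for [k <= a]. If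
    [k + l <= a], the chain ends at [l = 0] and zeros propagate to larger [l], as [k - i - l - 1] is
    negative for [i >= k]; the entries with [i < k] vanish by the first argument. *)
Lemma recursion_eq0 (c : nat -> nat -> nat -> F) (a b : nat) :
  (forall k l i, (a.+1 < k)%N -> c k l i = 0) ->
  (forall k l i, (a < l)%N -> c k l i = 0) ->
  (forall k l i, (if i is i'.+1 then (a.+1%:R - k%:R) * (k%:R - i'%:R - l%:R - 1) * c k l i' else 0)
  + (if l is l'.+1 then k.+1%:R * (a%:R + b%:R + 2%:R - k%:R) * c k.+1 l' i else 0) = 0) ->
  forall k l i, c k l i = 0.
Proof.
move=> cK cM rec.
have step k l i : (k <= a)%N -> (if i is i'.+1 then
    (a.+1%:R - k%:R) * (k%:R - i'%:R - l.+1%:R - 1) * c k l.+1 i' = 0 else True) ->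
    c k.+1 l i = 0.
  move=> ka; have := rec k l.+1 i => /[swap] h.
  have -> : (if i is i'.+1 then (a.+1%:R - k%:R) * (k%:R - i'%:R - l.+1%:R - 1) * c k l.+1 i' else 0) = 0.
    by case: i h.
  move=> /eqP; rewrite add0r !mulf_eq0 pnatr_eq0 /= => /orP[|/eqP //].
  by rewrite -!natrD subr_eq0 eqr_nat; lia.
have low k : forall l i, (i < k)%N -> c k l i = 0.
  elim: k => [//|k IHk] l i lt_ik; have [ak|ka] := ltnP a k; first exact: cK.
  by apply: step => //; case: i lt_ik => // i lt_ik; rewrite IHk ?mulr0.
have big k : forall l i, (a < k + l)%N -> c k l i = 0.
  elim: k => [|k IHk] l i lt_a; first exact: cM.
  have [ak|ka] := ltnP a k; first exact: cK.
  by apply: step => //; case: i => // i; rewrite IHk ?mulr0 // addnS -addSn.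
have small l : forall k i, (k + l <= a)%N -> c k l i = 0.
  have fac k i m : (k <= a)%N -> (k <= i)%N ->
      (a.+1%:R - k%:R) * (k%:R - i%:R - m%:R - 1) != 0 :> F.
    move=> ka ki; apply: mulf_neq0; first by rewrite subr_eq0 eqr_nat; lia.
    have -> : k%:R - i%:R - m%:R - 1 = - (i - k + m + 1)%N%:R :> F.
      by rewrite !natrD natrB //; ring.
    by rewrite oppr_eq0 pnatr_eq0 addn1.
  elim: l => [|l IHl] k i; rewrite ?addn0 => kla.
    have [/low//|ki] := ltnP i k; have := rec k 0%N i.+1; rewrite addr0 => /eqP.
    by rewrite mulf_eq0 (negPf (fac _ _ _ _ _)) //= => /eqP.
  have [/low//|ki] := ltnP i k; have := rec k l.+1 i.+1.
  rewrite IHl ?addSnnS // mulr0 addr0 => /eqP.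
  by rewrite mulf_eq0 (negPf (fac _ _ _ _ _)) ?(leq_trans (leq_addr _ _) kla) //= => /eqP.
move=> k l i; have [kla|akl] := leqP (k + l) a; [exact: small | exact: big].
Qed.

Lemma opL3_inj a b (f : poly3) : opL3 a b f = 0 ->
  (forall k, (a.+1 < k)%N -> f`_k = 0) -> (forall k l, (a < l)%N -> f`_k`_l = 0) -> f = 0.
Proof.
move=> Lf fK fM; apply/polyP => k; apply/polyP => l; apply/polyP => i; rewrite !coef0.
apply: (@recursion_eq0 (fun k l i => coef3 k l i f) a b) => {}k {}l {}i.
- by move=> /fK; rewrite /coef3 => ->; rewrite !coef0.
- by move=> /fM; rewrite /coef3 => ->; rewrite !coef0.
- by rewrite -coef3_opL3 Lf /coef3 !coef0.
Qed.

Lemma dK3C c : dK3 (const3 c) = 0. Proof. exact: derivC. Qed.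
Lemma dM3C c : dM3 (const3 c) = 0. Proof. by rewrite /dM3 map_polyC /= derivC. Qed.
Lemma dX3C c : dX3 (const3 c) = 0.
Proof. by rewrite /dX3 map_polyC /= map_polyC /= derivC. Qed.

Lemma dK3K : dK3 K3 = 1. Proof. exact: derivX. Qed.
Lemma dK3M : dK3 M3 = 0. Proof. exact: derivC. Qed.
Lemma dK3X : dK3 X3 = 0. Proof. exact: derivC. Qed.
Lemma dM3K : dM3 K3 = 0.
Proof. by apply/polyP => k; rewrite coef_map coefX /=; case: eqP; rewrite ?derivC ?coef0. Qed.
Lemma dM3M : dM3 M3 = 1. Proof. by rewrite /dM3 map_polyC /= derivX. Qed.
Lemma dM3X : dM3 X3 = 0. Proof. by rewrite /dM3 map_polyC /= derivC. Qed.
Lemma dX3K : dX3 K3 = 0.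
Proof.
apply/polyP => k; rewrite coef_map coefX /=; case: eqP => _; rewrite ?coef0 ?map_poly0 //.
by rewrite -[1]/(1%:P) map_polyC /= derivC.
Qed.
Lemma dX3M : dX3 M3 = 0.
Proof.
rewrite /dX3 map_polyC /=; apply/eqP; rewrite polyC_eq0; apply/eqP/polyP => k.
by rewrite coef_map coefX /=; case: eqP; rewrite ?derivC ?coef0.
Qed.
Lemma dX3X : dX3 X3 = 1. Proof. by rewrite /dX3 map_polyC /= map_polyC /= derivX. Qed.

Section LinearForms.
Variables p0 p1 p2 q0 q1 q2 : F.

Definition form_s : poly3 := X3 * const3 p0 + const3 p1 + M3 * const3 p2.
Definition form_t : poly3 := K3 * const3 q0 - (M3 + X3 * K3) * const3 q1 + const3 q2.

Lemma opL3_linear_forms a b : opL3 a b (form_s ^+ b * form_t ^+ a.+1) =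
  - orbit_expr a b form_s form_t X3 M3 K3
    (const3 p1) (const3 q0) (const3 q1) (const3 q2) *+ a.+1.
Proof.
have c3 c : [/\ dK3 (const3 c) = 0, dM3 (const3 c) = 0 & dX3 (const3 c) = 0].
  by rewrite dK3C dM3C dX3C.
exact: (opL_linear_forms_const a b (@dK3_derivation F) (@dM3_derivation F) (@dX3_derivation F)
  dK3K dK3M dK3X dM3K dM3M dM3X dX3K dX3M dX3X (c3 _) (c3 _) (c3 _) (c3 _) (c3 _) (c3 _)).
Qed.

End LinearForms.

Definition eval3_morph (k m x : F) : {rmorphism poly3 -> F} :=
  horner_eval x \o horner_eval m%:P \o horner_eval k%:P%:P.

Lemma eval3_morphE f k m x : eval3 f k m x = eval3_morph k m x f. Proof. by []. Qed.

Lemma eval3_const c k m x : eval3_morph k m x (const3 c) = c.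
Proof. by rewrite -eval3_morphE /eval3 !hornerC. Qed.

Lemma eval3_K k m x : eval3_morph k m x K3 = k.
Proof. by rewrite -eval3_morphE /eval3 hornerX !hornerC. Qed.

Lemma eval3_M k m x : eval3_morph k m x M3 = m.
Proof. by rewrite -eval3_morphE /eval3 hornerC hornerX hornerC. Qed.

Lemma eval3_X k m x : eval3_morph k m x X3 = x.
Proof. by rewrite -eval3_morphE /eval3 !hornerC hornerX. Qed.

Lemma eval3_form_s p0 p1 p2 k m x :
  eval3_morph k m x (form_s p0 p1 p2) = x * p0 + p1 + m * p2.
Proof.
have fE (f : {rmorphism poly3 -> F}) X M c0 c1 c2 :
  f (X * c0 + c1 + M * c2) = f X * f c0 + f c1 + f M * f c2 by rewrite !rmorphD !rmorphM.
apply: (etrans (fE (eval3_morph k m x) X3 M3 (const3 p0) (const3 p1) (const3 p2))).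
by rewrite !eval3_const eval3_X eval3_M.
Qed.

Lemma eval3_form_t q0 q1 q2 k m x :
  eval3_morph k m x (form_t q0 q1 q2) = k * q0 - (m + x * k) * q1 + q2.
Proof.
have fE (f : {rmorphism poly3 -> F}) K X M c0 c1 c2 :
  f (K * c0 - (M + X * K) * c1 + c2) = f K * f c0 - (f M + f X * f K) * f c1 + f c2.
  by rewrite !rmorphD rmorphN !rmorphM rmorphD rmorphM.
apply: (etrans (fE (eval3_morph k m x) K3 X3 M3 (const3 q0) (const3 q1) (const3 q2))).
by rewrite !eval3_const eval3_X eval3_M eval3_K.
Qed.

(** The degree in [K] is at most [a + 1] since only [t] involves [K]. The bound [a] on the degree in
    [M] cannot be seen on the individual forms and enters as the hypothesis on slices. *)
Lemma chart_forms_vanish a b (I : Type) (r : seq I) (e p0 p1 p2 q0 q1 q2 : I -> F) :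
  let s i k m x := x * p0 i + p1 i + m * p2 i in
  let t i k m x := k * q0 i - (m + x * k) * q1 i + q2 i in
  let f k m x := \sum_(i <- r) e i * (s i k m x ^+ b * t i k m x ^+ a.+1) in
  (forall k x, exists2 p : {poly F}, (size p <= a.+1)%N & forall m, f k m x = p.[m]) ->
  (forall k m x, \sum_(i <- r) e i * orbit_expr a b (s i k m x) (t i k m x)
     x m k (p1 i) (q0 i) (q1 i) (q2 i) = 0) ->
  forall k m x, f k m x = 0.
Proof.
move=> s t f slice eq0.
pose S i := form_s (p0 i) (p1 i) (p2 i); pose T i := form_t (q0 i) (q1 i) (q2 i).
pose Q : poly3 := \sum_(i <- r) const3 (e i) * (S i ^+ b * T i ^+ a.+1).
have fE k m x : eval3 Q k m x = f k m x.
  rewrite eval3_morphE /Q rmorph_sum; apply: eq_bigr => i _.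
  have ME (g : {rmorphism poly3 -> F}) u v w : g (u * (v ^+ b * w ^+ a.+1))
      = g u * (g v ^+ b * g w ^+ a.+1) by rewrite !rmorphM !rmorphXn.
  by rewrite [LHS]ME eval3_const eval3_form_s eval3_form_t.
suff Q0 : Q = 0 by move=> k m x; rewrite -fE Q0 eval3_morphE rmorph0.
have LQ r' : opL3 a b (\sum_(i <- r') const3 (e i) * (S i ^+ b * T i ^+ a.+1))
    = \sum_(i <- r') const3 (e i) * opL3 a b (S i ^+ b * T i ^+ a.+1).
  have L0 : opL3 a b 0 = 0.
    apply/polyP => k; apply/polyP => l; apply/polyP => j.
    have := coef3_opL3 a b 0 k l j; rewrite /coef3 => ->; rewrite !coef0.
    by case: j => [|j]; case: l => [|l]; rewrite ?coef0 ?mulr0 ?addr0.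
  elim: r' => [|i r' IHr]; first by rewrite !big_nil.
  rewrite !big_cons -IHr.
  exact: (opL_linear K3 M3 X3 a b (@dK3_derivation F) (@dM3_derivation F) (@dX3_derivation F)
    _ _ (dK3C _) (dM3C _) (dX3C _)).
apply: (@opL3_inj a b).
- apply: eval3_eq0 => k m x; rewrite eval3_morphE LQ rmorph_sum.
  pose U i := orbit_expr a b (s i k m x) (t i k m x) x m k (p1 i) (q0 i) (q1 i) (q2 i).
  transitivity (\sum_(i <- r) - (e i * U i) *+ a.+1).
    apply: eq_bigr => i _; rewrite opL3_linear_forms.
    have ME (g : {rmorphism poly3 -> F}) u v : g (u * (- v *+ a.+1)) = - (g u * g v) *+ a.+1.
      by rewrite rmorphM rmorphMn rmorphN mulrnAr mulrN.
    rewrite [LHS]ME rmorph_orbit_expr eval3_form_s eval3_form_t !eval3_const.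
    by rewrite eval3_K eval3_M eval3_X.
  by rewrite sumrMnl sumrN eq0 oppr0 mul0rn.
- move=> k lt_ak; have sz (u v : poly3) : (size u <= 1)%N -> (size v <= 2)%N ->
    (size (u ^+ b * v ^+ a.+1)%R <= a.+2)%N.
    move=> su sv; apply: leq_trans (size_polyMleq _ _) _.
    have := size_poly_exp_leq u b; have := size_poly_exp_leq v a.+1; nia.
  have sS i : (size (S i) <= 1)%N.
    have -> : S i = ('X%:P * (p0 i)%:P%:P + (p1 i)%:P%:P + 'X * (p2 i)%:P%:P)%:P.
      by rewrite /S /form_s /X3 /M3 /const3 !polyCD !polyCM.
    exact: size_polyC_leq1.
  have sT i : (size (T i) <= 2)%N.
    have -> : T i = ((q0 i)%:P%:P - 'X%:P * (q1 i)%:P%:P)%:P * 'X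
        + ((q2 i)%:P%:P - 'X * (q1 i)%:P%:P)%:P.
      by rewrite /T /form_t /X3 /M3 /K3 /const3 !polyCB !polyCM; ring.
    by rewrite -cons_poly_def size_cons_poly; case: ifP => // _; rewrite ltnS size_polyC_leq1.
  rewrite /Q coef_sum big1 // => i _; rewrite coefCM nth_default ?mulr0 //.
  by apply: leq_trans lt_ak; apply: sz.
apply: coef_eq0_slice => k x; have [p sp pE] := slice k x.
by exists p => // m; rewrite fE.
Qed.

End ChartRecursion.

(** * Injectivity of the operator Y |-> sum T_i Y T_i *)

Section FixedVector.
Variable R : realType.
Local Notation C := R[i].
Variables (a b Nmu Nnu : nat).
Variables (rmu : 'M[C]_3 -> 'M[C]_Nmu) (rnu : 'M[C]_3 -> 'M[C]_Nnu).
Variables (vmu : 'rV[C]_Nmu) (xmu : 'cV[C]_Nmu) (vnu : 'rV[C]_Nnu) (xnu : 'cV[C]_Nnu).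
Variable T : 'I_3 -> 'M[C]_(Nmu, Nnu).
Hypothesis D : invariant_data a b rmu rnu vmu xmu vnu xnu T.

Definition omega (Y : 'M[C]_(Nnu, Nmu)) : 'M[C]_(Nmu, Nnu) := \sum_i T i *m Y *m T i.

Lemma omega_equivariant g Y : g \in unitmx ->
  omega (rnu g *m Y *m rmu g^T) = rmu g *m omega Y *m rnu g^T.
Proof.
move=> ug; have ugT : g^T \in unitmx by rewrite unitmx_tr.
transitivity (\sum_i \sum_j g i j *: (rmu g *m T j *m Y *m (rmu g^T *m T i))).
  apply: eq_bigr => i _; rewrite !mulmxA -(inv_tensor D) // !mulmx_suml.
  by apply: eq_bigr => j _; rewrite -!scalemxAl !mulmxA.
rewrite exchange_big /omega mulmx_sumr mulmx_suml; apply: eq_bigr => j _ /=.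
rewrite -[RHS]mulmxA -(mulmxA (T j *m Y)) -(inv_tensor D) // !mulmx_sumr.
by apply: eq_bigr => i _; rewrite mxE -!scalemxAr !mulmxA.
Qed.

Lemma coefmx_omega k (Y : 'M[{poly C}]_(Nnu, Nmu)) :
  (forall u, u != 0 -> omega (evmx u Y) = 0) -> omega (coefmx k Y) = 0.
Proof.
move=> Y0; pose TY : 'M[{poly C}]_(Nmu, Nnu) :=
  \sum_i map_mx polyC (T i) *m Y *m map_mx polyC (T i).
have -> : omega (coefmx k Y) = coefmx k TY.
  rewrite [RHS](raddf_sum (map_mx (coefp k))); apply: eq_bigr => i _.
  by rewrite [RHS]coefmx_mulr coefmx_mull.
suff -> : TY = 0 by rewrite [LHS](raddf0 (map_mx (coefp k))).
apply: evmx_eq => u u0; rewrite [RHS](raddf0 (map_mx (horner_eval u))) -(Y0 u u0).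
rewrite [LHS](raddf_sum (map_mx (horner_eval u))); apply: eq_bigr => i _.
by rewrite [LHS]evmxM evmxM !evmx_polyC.
Qed.

(** A homogeneous kernel element of maximal degree is taken. Unipotents add only components of
    higher degree; these lie in the kernel again and vanish by maximality. *)
Lemma kernel_fixed Y0 : Y0 != 0 -> omega Y0 = 0 ->
  exists Y, [/\ Y != 0, omega Y = 0
    & forall n, unipotent n -> rnu n *m Y *m rmu n^T = Y].
Proof.
move=> Y00 oY0.
have [A [rA AA A1]] := torus_grading (nuG D) (nuP D) hgt.
have [B [rB BB B1]] := torus_grading (muG D) (muP D) hgt.
have tT (u : C) : (torus hgt u)^T = torus hgt u by rewrite tr_diag_mx.
pose act Y := A *m map_mx polyC Y *m B.
have actE Y u : u != 0 -> evmx u (act Y) = rnu (torus hgt u) *m Y *m rmu (torus hgt u)^T.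
  by move=> u0; rewrite tT rA // rB // -[X in _ *m X *m _](evmx_polyC u) -!evmxM.
pose homog k Y := [/\ omega Y = 0 & act Y = 'X^k *: map_mx polyC Y].
have homog_coef k Y : omega Y = 0 -> homog k (coefmx k (act Y)).
  move=> oY; split.
    apply: coefmx_omega => u u0; rewrite actE // omega_equivariant ?torus_unit //.
    by rewrite oY mulmx0 mul0mx.
  apply: evmx_eq => v v0; rewrite evmxZXn evmx_polyC -coefmx_dilate !evmxM evmx_polyC.
  rewrite -!coefmx_mull -!coefmx_mulr; congr coefmx.
  apply: evmx_eq => u u0; rewrite evmx_dilate !evmxM !evmx_polyC.
  have -> : evmx (v * u) B = evmx u B *m evmx v B.
    by rewrite -!rB ?mulf_neq0 // mulrC torusM (repM (muG D)) ?torus_unit.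
  by rewrite -!rA ?mulf_neq0 // torusM (repM (nuG D)) ?torus_unit // !mulmxA.
(* The degree of a homogeneous element is the sum of a weight of [rnu] and a weight of [rmu], both
   bounded, so a maximal degree exists. *)
have bound : exists d, forall k Y, homog k Y -> Y != 0 -> (k <= d)%N.
  have [dA bA] := coefmx_bound A; have [dB bB] := coefmx_bound B.
  exists (dA + dB)%N => k Y [_ hY]; apply: contraNT; rewrite -ltnNge => lt_k.
  have YE : Y = (\sum_(i < dA) coefmx i A) *m Y *m (\sum_(j < dB) coefmx j B).
    have sE N (Z : 'M[{poly C}]_N) d : (forall k, (d <= k)%N -> coefmx k Z = 0) ->
        \sum_(i < d) coefmx i Z = evmx 1 Z.
      by move=> /evmx_sum->; apply: eq_bigr => i _; rewrite expr1n scale1r.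
    by rewrite !sE // A1 B1 mul1mx mulmx1.
  rewrite YE mulmx_suml mulmx_suml big1 // => i _; rewrite mulmx_sumr big1 // => j _.
  have := congr1 (fun Z => coefmx k (map_mx polyC (coefmx i A) *m Z *m map_mx polyC (coefmx j B))) hY.
  rewrite /act !mulmxA (grading_mull AA) -mulmxA -!scalemxAl -!mulmxA (grading_mulr BB).
  rewrite -!scalemxAr -!scalemxAl !mulmxA -!map_mxM. rewrite -scalemxAr -map_mxM mulmxA scalerA -exprD !coefmxXn !coefmx_polyC ltnn subnn.
  move=> /= <-; case: ltnP => // le_k; rewrite subn_eq0 leqNgt.
  by rewrite (leq_ltn_trans _ lt_k) // leq_add // ltnW.
have act1 Y : evmx 1 (act Y) = Y by rewrite !evmxM evmx_polyC A1 B1 mul1mx mulmx1.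
pose Q k := `[< exists2 Y, homog k Y & Y != 0 >].
have Q0 : exists k, Q k.
  apply: contrapT => nQ; case/eqP: Y00; rewrite -(act1 Y0).
  suff -> : act Y0 = 0 by rewrite [LHS](raddf0 (map_mx (horner_eval 1))).
  apply: eq_coefmx => k; rewrite [RHS](raddf0 (map_mx (coefp k))).
  apply: contrapT => /eqP nz; apply: nQ; exists k; apply/asboolP.
  by exists (coefmx k (act Y0)); first exact: homog_coef.
have [d bd] := bound.
have Qd k : Q k -> (k <= d)%N by move=> /asboolP[Y hY]; apply: bd hY.
case: (ex_maxnP Q0 Qd) => k /asboolP[Y [oY hY] Yn0] kmax.
exists Y; split=> // n un.
have un' : n^T \in unitmx by rewrite unitmx_tr unipotent_unit.
set Z := rnu n *m Y *m rmu n^T.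
have oZ : omega Z = 0.
  by rewrite omega_equivariant ?unipotent_unit // oY mulmx0 mul0mx.
have [E E0 eE] := rep_contraction_upper (nuG D) (nuP D) rA un.
have [E' E'0 eE'] := rep_contraction_lower (muG D) (muP D) rB un.
have aZ : act Z = 'X^k *: (E *m map_mx polyC Y *m E').
  have -> : act Z = E *m act Y *m E'.
    by rewrite /act !map_mxM !mulmxA eE -!mulmxA eE' !mulmxA.
  by rewrite hY -scalemxAr -scalemxAl.
have : act Z = 'X^k *: map_mx polyC Y.
  apply: eq_coefmx => j; rewrite [in RHS]coefmxXn coefmx_polyC subn_eq0.
  case: ltngtP => [lt_jk|lt_kj|->].
  - by rewrite aZ coefmxXn lt_jk.
  - apply: contrapT => /eqP nz; suff /kmax : Q j by rewrite leqNgt lt_kj.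
    by apply/asboolP; exists (coefmx j (act Z)); first exact: homog_coef.
  have ev0 p q (M : 'M[{poly C}]_(p, q)) : coefmx 0 M = evmx 0 M.
    by apply/matrixP => r c; rewrite !mxE /= /horner_eval horner_coef0.
  by rewrite aZ coefmxXn ltnn subnn ev0 !evmxM evmx_polyC -!ev0 E0 E'0 mul1mx mulmx1.
by move/(congr1 (evmx 1)); rewrite act1 evmxZXn evmx_polyC expr1n scale1r.
Qed.

End FixedVector.

(** * The chart of the flag variety *)

Section Chart.
Variable R : realType.
Local Notation C := R[i].

(** These are the products of an upper unipotent with the rotation [chart 0 0 0]. In this placement
    right multiplication by [e12] only shifts [m]. *)
Definition chart (k m x : C) : 'M[C]_3 := mx3 [:: [:: x; 1; m]; [:: -1; 0; k]; [:: 0; 0; 1]].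
Definition e01 (u : C) : 'M[C]_3 := mx3 [:: [:: 1; u; 0]; [:: 0; 1; 0]; [:: 0; 0; 1]].
Definition e12 (u : C) : 'M[C]_3 := mx3 [:: [:: 1; 0; 0]; [:: 0; 1; u]; [:: 0; 0; 1]].

Lemma chart_unit k m x : chart k m x \in unitmx.
Proof.
rewrite unitmxE unitfE det3 !mxE /=.
by rewrite (_ : _ + _ = 1) ?oner_eq0 //; ring.
Qed.

Lemma unipotent_e01 u : unipotent (e01 u).
Proof. by apply: ord3P; apply: ord3P => //= _; rewrite !mxE. Qed.

Lemma unipotent_e12 u : unipotent (e12 u).
Proof. by apply: ord3P; apply: ord3P => //= _; rewrite !mxE. Qed.

Lemma e01K u : e01 (- u) *m e01 u = 1%:M.
Proof. by apply/matrixP; apply: ord3P; apply: ord3P; rewrite !mxE sum3 !mxE /=; ring. Qed.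

Lemma e12K u : e12 (- u) *m e12 u = 1%:M.
Proof. by apply/matrixP; apply: ord3P; apply: ord3P; rewrite !mxE sum3 !mxE /=; ring. Qed.

Lemma chart_e12 k m x : chart k m x = chart k 0 x *m e12 m.
Proof. by apply/matrixP; apply: ord3P; apply: ord3P; rewrite !mxE sum3 !mxE /=; ring. Qed.

Lemma unipotent_chart (n : 'M[C]_3) : unipotent n -> exists k m x, n *m chart k m x = chart 0 0 0.
Proof.
move=> un; exists (- n 1 2), (n 0 1 * n 1 2 - n 0 2), (n 0 1).
have [n00 n11 n22] : [/\ n 0 0 = 1, n 1 1 = 1 & n 2 2 = 1] by rewrite !un.
have [n10 n20 n21] : [/\ n 1 0 = 0, n 2 0 = 0 & n 2 1 = 0] by rewrite !un.
apply/matrixP; apply: ord3P; apply: ord3P;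
  rewrite mxE sum3 !mxE /= ?n00 ?n11 ?n22 ?n10 ?n20 ?n21; ring.
Qed.

(** The three coordinates form the cross product of the first two columns of [h]. *)
Definition pluecker0 (h : 'M[C]_3) := h 1 0 * h 2 1 - h 2 0 * h 1 1.
Definition pluecker1 (h : 'M[C]_3) := h 2 0 * h 0 1 - h 0 0 * h 2 1.
Definition pluecker2 (h : 'M[C]_3) := h 0 0 * h 1 1 - h 1 0 * h 0 1.


Lemma chart_00 k m x (h : 'M[C]_3) : (chart k m x *m h) 0 0 = x * h 0 0 + h 1 0 + m * h 2 0.
Proof. by rewrite mxE sum3 !mxE /=; ring. Qed.

Lemma chart_01 k m x (h : 'M[C]_3) : (chart k m x *m h) 0 1 = x * h 0 1 + h 1 1 + m * h 2 1.
Proof. by rewrite mxE sum3 !mxE /=; ring. Qed.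

Lemma chart_minor2 k m x h : minor2 (chart k m x *m h) =
  k * pluecker0 h - (m + x * k) * pluecker1 h + pluecker2 h.
Proof.
rewrite /minor2 !mxE !sum3 !mxE /= /pluecker0 /pluecker1 /pluecker2; ring.
Qed.

Lemma coefmx_horner m n p (z : 'M[C]_(m, n)) N (A : 'M[{poly C}]_(n, N)) (w : 'M[C]_(N, p)) i j q :
  (forall u, u != 0 -> (z *m evmx u A *m w) i j = q.[u]) ->
  forall k, (z *m coefmx k A *m w) i j = q`_k.
Proof.
move=> zAw k; rewrite -coefmx_mull -coefmx_mulr coefmxE.
suff -> : (map_mx polyC z *m A *m map_mx polyC w) i j = q by [].
apply: (@poly_eq_generic _ 'X); rewrite ?polyX_eq0 // => u.
by rewrite hornerX => /zAw <-; rewrite -evmxE !evmxM !evmx_polyC.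
Qed.

End Chart.

(** * Vanishing of the fixed kernel vectors *)

Section KernelTrivial.
Variable R : realType.
Local Notation C := R[i].
Variables (a b Nmu Nnu : nat).
Variables (rmu : 'M[C]_3 -> 'M[C]_Nmu) (rnu : 'M[C]_3 -> 'M[C]_Nnu).
Variables (vmu : 'rV[C]_Nmu) (xmu : 'cV[C]_Nmu) (vnu : 'rV[C]_Nnu) (xnu : 'cV[C]_Nnu).
Variable T : 'I_3 -> 'M[C]_(Nmu, Nnu).
Hypothesis D : invariant_data a b rmu rnu vmu xmu vnu xnu T.

Lemma mu_coefficient g : g \in unitmx ->
  vmu *m rmu g *m xmu = (g 0 0 ^+ b.+1 * minor2 g ^+ a)%:M.
Proof.
move=> ug; rewrite (matrix_coefficient (muG D) (muP D) (muW D)) //; last by rewrite -addnA leq_addr.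
by rewrite -addnA addKn addn1.
Qed.

Lemma nu_coefficient g : g \in unitmx ->
  vnu *m rnu g *m xnu = (g 0 0 ^+ b * minor2 g ^+ a.+1)%:M.
Proof.
move=> ug; rewrite (matrix_coefficient (nuG D) (nuP D) (nuW D)) //; last by rewrite leq_add2r leq_addr.
by rewrite subnDr addKn addn1.
Qed.

Lemma coef1E (p : {poly C}) : p`_1%N = p^`().[0].
Proof. by rewrite horner_coef0 coef_deriv. Qed.

Section Extremal.
Variable c : C.
Hypothesis c0 : c != 0.
Hypothesis cE : forall g, g \in unitmx -> forall i,
  vmu *m rmu g *m T i *m xnu = (c * (g 0 0 ^+ b * minor2 g ^+ a * extremal g i))%:M.

Lemma extremal_orbit g h i : g \in unitmx -> h \in unitmx ->
  (vmu *m rmu g *m T i *m rnu h *m xnu) 0 0 =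
  c * ((g *m h) 0 0 ^+ b * minor2 (g *m h) ^+ a
       * (h i 1 * (g *m h) 0 0 - h i 0 * (g *m h) 0 1)).
Proof.
move=> ug uh; rewrite -[vmu *m _ *m T i *m _]mulmxA -(inv_tensor D) //.
rewrite mulmx_sumr mulmx_suml summxE.
have term j : (vmu *m rmu g *m (h i j *: (rmu h *m T j)) *m xnu) 0 0 =
    h i j * (c * ((g *m h) 0 0 ^+ b * minor2 (g *m h) ^+ a * extremal (g *m h) j)).
  rewrite -scalemxAr -scalemxAl mulmxA -(mulmxA vmu) -(repM (muG D)) // cE ?unitmx_mul ?ug //.
  by rewrite !mxE mulr1n.
rewrite (eq_bigr _ (fun j _ => term j)) sum3 /extremal /=; ring.
Qed.

Lemma T2_xnu : T 2 *m xnu = 0.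
Proof.
apply: (col_eq0_orbit (muG D) (muW D) (muI D)) => g ug.
by rewrite mulmxA cE // /extremal /= !mulr0 -scalemx1 scale0r.
Qed.

Lemma T1_xnu : T 1 *m xnu = c *: xmu.
Proof.
apply/eqP; rewrite -subr_eq0; apply/eqP.
apply: (col_eq0_orbit (muG D) (muW D) (muI D)) => g ug.
rewrite mulmxBr mulmxA cE // -scalemxAr mu_coefficient // scale_scalar_mx /extremal /=.
by rewrite [g 0 0 ^+ b.+1]exprSr mulrAC subrr.
Qed.

(** [coefmx 1 A] is the lowering operator [E_10]. Its matrix coefficient is the derivative of
    [(g_00 + u g_01)^(b+1) minor2^a] at 0, proportional to the extremal coefficient for [i = 0]. *)
Lemma T0_xnu (A : 'M[{poly C}]_Nmu) :
  (forall u, u != 0 -> rmu (e01 u)^T = evmx u A) ->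
  T 0 *m xnu *+ b.+1 = - c *: (coefmx 1 A *m xmu).
Proof.
move=> eA; apply/eqP; rewrite -subr_eq0 scaleNr opprK; apply/eqP.
apply: (col_eq0_orbit (muG D) (muW D) (muI D)) => g ug.
rewrite mulmxDr -scalemxAr mulmxA.
have -> : vmu *m rmu g *m coefmx 1 A *m xmu
    = ((((g 0 0)%:P + (g 0 1) *: 'X) ^+ b.+1 * (minor2 g ^+ a)%:P)`_1%N)%:M.
  rewrite [LHS]mx11_scalar; congr (_%:M); apply: coefmx_horner => u u0.
  have ue : (e01 u)^T \in unitmx by rewrite unitmx_tr unipotent_unit //; apply: unipotent_e01.
  rewrite -eA // -(mulmxA vmu) -(repM (muG D)) // mu_coefficient ?unitmx_mul ?ug //.
  rewrite !mxE mulr1n !hornerE /minor2 !mxE !sum3 !mxE /=.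
  by congr (_ ^+ _ * _ ^+ _); ring.
rewrite coefMC coef1E deriv_exp !derivE add0r alg_polyC.
rewrite -scaler_nat -scalemxAr mulmxA cE // !scale_scalar_mx -raddfD /extremal /=.
rewrite !(hornerMn, hornerM, hornerD, hornerZ, horner_exp, hornerC, hornerX).
by rewrite mulr0 addr0 [X in X%:M](_ : _ = 0) ?raddf0 //; ring.
Qed.

(* [g *m (e12 (- u))^T] subtracts [u] times the last column from the middle one,
   so [minor2] becomes affine in [u]. *)
Lemma lower_degree (A : 'M[{poly C}]_Nmu) :
  (forall u, u != 0 -> rmu (e12 (- u))^T = evmx u A) ->
  forall k, (a < k)%N -> coefmx k A *m xmu = 0.
Proof.
move=> eA k lt_ak; apply: (col_eq0_orbit (muG D) (muW D) (muI D)) => g ug; rewrite mulmxA.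
pose p : {poly C} := (g 0 0 ^+ b.+1)%:P
  * ((minor2 g)%:P - (g 0 0 * g 1 2 - g 0 2 * g 1 0) *: 'X) ^+ a.
rewrite [LHS]mx11_scalar (@coefmx_horner _ _ _ _ _ _ A xmu 0 0 p) => [|u u0].
  rewrite nth_default ?raddf0 // /p; apply: leq_trans lt_ak.
  set q := _ - _; have sq : (size q <= 2)%N.
    apply: leq_trans (size_polyD _ _) _; rewrite geq_max size_polyN.
    rewrite (leq_trans (size_polyC_leq1 _)) //.
    by apply: leq_trans (size_scale_leq _ _) _; rewrite size_polyX.
  have sqa : (size (q ^+ a)%R <= a.+1)%N.
    apply: leq_trans (size_poly_exp_leq _ _) _.
    by rewrite ltnS -{2}[a]mul1n leq_mul2r -subn1 leq_subLR sq orbT.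
  apply: leq_trans (size_polyMleq _ _) _; rewrite -subn1 leq_subLR.
  exact: leq_add (size_polyC_leq1 _) sqa.
have ue : (e12 (- u))^T \in unitmx by rewrite unitmx_tr unipotent_unit //; apply: unipotent_e12.
rewrite -eA // -(mulmxA vmu) -(repM (muG D)) // mu_coefficient ?unitmx_mul ?ug //.
rewrite /p !hornerE /minor2 !mxE !sum3 !mxE /= mulr1n.
by congr (_ ^+ _ * _ ^+ _); ring.
Qed.

(** Replacing [h] by [e01 (- u) *m h] in [extremal_orbit] makes both forms and the extremal factor
    affine in [u]. As [coefmx 1 A] is minus [E_01], the derivative at 0 gives the second term. *)
Lemma orbit_value (A : 'M[{poly C}]_Nnu) k m x h : h \in unitmx ->
  (forall u, u != 0 -> rnu (e01 (- u)) = evmx u A) ->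
  let g := chart k m x in
  (vmu *m rmu g *m T 1 *m (rnu h *m xnu)) 0 0 *+ b.+1
    - (vmu *m rmu g *m T 0 *m coefmx 1 A *m (rnu h *m xnu)) 0 0 =
  c * orbit_expr a b ((g *m h) 0 0) (minor2 (g *m h)) x m k
    (h 1 0) (pluecker0 h) (pluecker1 h) (pluecker2 h).
Proof.
move=> uh eA g; have ug : g \in unitmx by exact: chart_unit.
set S := (g *m h) 0 0; set M := minor2 (g *m h).
pose p : {poly C} := c%:P * ((S%:P - (x * h 1 0) *: 'X) ^+ b
  * (M%:P - ((m + x * k) * pluecker0 h) *: 'X) ^+ a
  * ((m * pluecker1 h - pluecker2 h)%:P + (m * pluecker0 h) *: 'X)).
rewrite (@coefmx_horner _ _ _ _ _ _ A (rnu h *m xnu) 0 0 p) => [|u u0].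
  rewrite coef1E /p !derivM !deriv_exp !derivE.
  rewrite mulmxA extremal_orbit // -/S -/M !alg_polyC.
  have -> : h 1 1 * S - h 1 0 * (g *m h) 0 1 = x * pluecker2 h - m * pluecker0 h.
    by rewrite /S !mxE !sum3 !mxE /= /pluecker2 /pluecker0; ring.
  rewrite !(hornerM, hornerMn, hornerD, hornerN, hornerZ, horner_exp, hornerC, hornerX, horner0).
  by rewrite !mulr0 !subr0 !addr0 !add0r /orbit_expr; ring.
have ue : e01 (- u) \in unitmx by apply: unipotent_unit; exact: unipotent_e01.
rewrite -eA // mulmxA -(mulmxA (vmu *m rmu g *m T 0)) -(repM (nuG D)) //.
rewrite extremal_orbit ?unitmx_mul ?ue // /p !(hornerM, horner_exp, hornerD, hornerN, hornerZ, hornerC, hornerX).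
have h0 j : (e01 (- u) *m h) 0 j = h 0 j - u * h 1 j.
  by rewrite mxE sum3 !mxE /=; ring.
have h1 j : (e01 (- u) *m h) 1 j = h 1 j by rewrite mxE sum3 !mxE /=; ring.
have h2 j : (e01 (- u) *m h) 2 j = h 2 j by rewrite mxE sum3 !mxE /=; ring.
congr (_ * (_ ^+ _ * _ ^+ _ * _)).
- by rewrite /S !chart_00 h0 h1 h2; ring.
- by rewrite /M !chart_minor2 /pluecker0 /pluecker1 /pluecker2 !h0 !h1 !h2; ring.
by rewrite chart_00 chart_01 !h0 !h1 !h2 /pluecker0 /pluecker1 /pluecker2; ring.
Qed.

Lemma kernel_fixed_eq0 Y : omega T Y = 0 ->
  (forall n, unipotent n -> rnu n *m Y *m rmu n^T = Y) -> Y = 0.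
Proof.
move=> oY fixY; have [eta etaD] : exists eta, eta = Y *m xmu by exists (Y *m xmu).
have fixY' n n' : unipotent n -> unipotent n' -> n' *m n = 1%:M ->
    Y *m rmu n^T = rnu n' *m Y.
  move=> un un' nn; rewrite -[in RHS](fixY n un) !mulmxA -(repM (nuG D)) ?unipotent_unit //.
  by rewrite nn (rep1 (nuG D)) mul1mx.
(* By density only [Y *m rmu l^T *m xmu] matters, and [Y] carries [rmu l^T] to the inverse of
   [rnu l]. *)
have eta0_Y0 : eta = 0 -> Y = 0.
  rewrite etaD => eta0; apply/row_matrixP => i; rewrite row0.
  apply: (row_eq0_orbit (muG D) (muW D) (muI D)) => g ug; apply/matrixP => i' j.
  rewrite !ord1 [RHS]mxE; move: g ug; apply: big_cell_dense => [|g ug g0 d0].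
    exact: (rep_coef_regular (muP D)).
  have [l [m [t [ul um t0 gm _]]]] := big_cell ug g0 d0.
  have [um' ul'] := (unipotent_unit um, unipotent_unit ul).
  rewrite -(hw_upper (muW D) um) mulmxA -(mulmxA (row i Y)) -(repM (muG D)) // gm.
  rewrite (repM (muG D)) ?unitmx_tr ?diag_unit // -!mulmxA (hw_torusr (muW D)) //.
  rewrite -!scalemxAr mulmxA -row_mul.
  have -> : row i (Y *m rmu l^T) *m xmu = 0; last by rewrite scaler0 mxE.
  rewrite -row_mul.
  have /(congr1 (mulmx (invmx (rnu l)))) : rnu l *m (Y *m rmu l^T *m xmu) = 0.
    by rewrite !mulmxA fixY.
  by rewrite mulKmx ?(rep_unit (nuG D)) // mulmx0 => ->; rewrite row0.
apply: eta0_Y0; have [s us etaE] := orbit_span (nuG D) (nuW D) (nuI D) eta.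
have chart_eta k m x : (vnu *m rnu (chart k m x) *m eta) 0 0 =
    \sum_(y <- s) y.1 * ((x * y.2 0 0 + y.2 1 0 + m * y.2 2 0) ^+ b
      * (k * pluecker0 y.2 - (m + x * k) * pluecker1 y.2 + pluecker2 y.2) ^+ a.+1).
  rewrite etaE mulmx_sumr summxE !big_seq; apply: eq_bigr => y /(allP us) uy.
  rewrite -scalemxAr mxE mulmxA -(mulmxA vnu) -(repM (nuG D)) ?chart_unit //.
  by rewrite nu_coefficient ?unitmx_mul ?chart_unit // -chart_minor2 -(chart_00 k) [_%:M 0 0]mxE mulr1n.
have vanish k m x : (vnu *m rnu (chart k m x) *m eta) 0 0 = 0.
  rewrite chart_eta; move: k m x; apply: chart_forms_vanish.
    (* Shifting [m] multiplies the chart by [e12 m]; [Y] converts this into [rmu (e12 (- m))^T]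
       acting on [xmu], which has degree at most [a] in [m]. *)
    move=> k x.
    pose G : 'M[{poly C}]_3 := mx3 [:: [:: 1; 0; 0]; [:: 0; 1; 0]; [:: 0; - 'X; 1]].
    have eG u : evmx u G = (e12 (- u))^T.
      apply/matrixP; apply: ord3P; apply: ord3P; rewrite !mxE /horner_eval /=
        ?hornerN ?hornerX ?hornerC //.
    have uG u : evmx u G \in unitmx.
      by rewrite eG unitmx_tr unipotent_unit //; apply: unipotent_e12.
    have [A eA] := rep_curve (muP D) G.
    have {}eA u : rmu (e12 (- u))^T = evmx u A by rewrite -eG eA.
    pose z := vnu *m rnu (chart k 0 x) *m Y.
    exists ((map_mx polyC z *m A *m map_mx polyC xmu) 0 0) => [|m].
      apply/leq_sizeP => j lt_aj; rewrite -coefmxE coefmx_mulr coefmx_mull -mulmxA.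
      by rewrite (lower_degree (fun u _ => eA u)) // mulmx0 mxE.
    rewrite -chart_eta -evmxE !evmxM !evmx_polyC -eA chart_e12.
    rewrite (repM (nuG D)) ?chart_unit ?unipotent_unit //; last exact: unipotent_e12.
    rewrite /z etaD -!mulmxA [Y *m (_ *m _)]mulmxA (fixY' _ (e12 m)) ?mulmxA //;
      try exact: unipotent_e12.
    by rewrite -[in X in X *m _](opprK m) e12K.
  pose G (w : C) : 'M[{poly C}]_3 := mx3 [:: [:: 1; w *: 'X; 0]; [:: 0; 1; 0]; [:: 0; 0; 1]].
  have eG w u : evmx u (G w) = e01 (w * u).
    apply/matrixP; apply: ord3P; apply: ord3P; rewrite !mxE /horner_eval /=
      ?hornerZ ?hornerX ?hornerC //.
  have e01u u : e01 u \in unitmx by apply: unipotent_unit; exact: unipotent_e01.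
  have evT u : evmx u (G 1)^T = (e01 u)^T by rewrite -[u in RHS]mul1r -eG /evmx map_trmx.
  have [A eA] := rep_curve (muP D) (G 1)^T.
  have {}eA u : rmu (e01 u)^T = evmx u A by rewrite -evT eA // evT unitmx_tr e01u.
  have [B eB] := rep_curve (nuP D) (G (-1)).
  have {}eB u : rnu (e01 (- u)) = evmx u B by rewrite -mulN1r -eG eB // eG e01u.
  (* In degree 1, [Y] carries the lowering operator [E_10] of [rmu] to minus [E_01] of [rnu]. *)
  have YA : map_mx polyC Y *m A = B *m map_mx polyC Y.
    apply: evmx_eq => u u0; rewrite !evmxM !evmx_polyC -eA -eB.
    by apply: fixY'; rewrite ?e01K //; exact: unipotent_e01.
  have Yc : Y *m coefmx 1 A = coefmx 1 B *m Y by rewrite -coefmx_mull YA coefmx_mulr.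
  (* This is [omega T Y *m xnu = 0], multiplied by [b + 1] so that [T0_xnu] applies and then divided
     by [c]. *)
  have key : T 1 *m eta *+ b.+1 = T 0 *m (coefmx 1 B *m eta).
    apply: (scalerI c0); apply/eqP; rewrite -subr_eq0; apply/eqP.
    have : (omega T Y *m xnu) *+ b.+1 = 0 by rewrite oY mul0mx mul0rn.
    rewrite /omega sum3 !mulmxDl -!(mulmxA _ _ xnu) T2_xnu T1_xnu mulmx0 addr0 mulrnDl.
    rewrite -scaler_nat scalemxAr scaler_nat (T0_xnu (fun u _ => eA u)).
    rewrite -!scalemxAr -!mulmxA [Y *m (coefmx 1 A *m xmu)]mulmxA Yc -!mulmxA -etaD => <-.
    by rewrite scaleNr addrC scalerMnr.
  move=> k m x; apply: (mulfI c0); rewrite mulr0.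
  have : (vmu *m rmu (chart k m x) *m (T 1 *m eta *+ b.+1 - T 0 *m (coefmx 1 B *m eta))) 0 0 = 0.
    by rewrite key subrr mulmx0 mxE.
  rewrite mulmxBr -scaler_nat -scalemxAr !mulmxA etaE !mulmx_sumr => E0; rewrite -[RHS]E0.
  rewrite [RHS]mxE [X in _ = X + _]mxE [X in _ = _ + X]mxE !summxE !mulr_sumr -sumrB.
  rewrite [LHS]big_seq [RHS]big_seq.
  apply: eq_bigr => y /(allP us) uy.
  rewrite mulrCA -!(chart_00 k) -chart_minor2 -(orbit_value _ _ _ uy (fun u _ => eB u)).
  have sE (w : 'M[C]_1) : (y.1 *: w) 0 0 = y.1 * w 0 0 by rewrite mxE.
  by rewrite -!scalemxAr !sE; ring.
have w_unit : (chart 0 0 0 : 'M[C]_3) \in unitmx by exact: chart_unit.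
(* Upper unipotents times [chart 0 0 0] are exactly the chart, so vanishing there gives vanishing
   matrix coefficients of this column on the big cell. *)
suff : rnu (chart 0 0 0) *m eta = 0.
  by move/(congr1 (mulmx (invmx (rnu (chart 0 0 0))))); rewrite mulmx0 mulKmx // (rep_unit (nuG D)).
apply: (col_eq0_orbit (nuG D) (nuW D) (nuI D)) => g ug; apply/matrixP => i j.
rewrite !ord1 [RHS]mxE; move: g ug; apply: big_cell_dense => [|g ug g0 d0].
  exact: (rep_coef_regular (nuP D)).
have [l [m [t [ul um t0 gm _]]]] := big_cell ug g0 d0.
have [um' ul'] := (unipotent_unit um, unipotent_unit ul).
have [n [n' [n'' En]]] := unipotent_chart um.
rewrite -En mulmxA -(mulmxA vnu) -(repM (nuG D)) ?unitmx_mul ?chart_unit ?um' //.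
rewrite mulmxA gm !(repM (nuG D)) ?unitmx_mul ?unitmx_tr ?diag_unit ?chart_unit ?ul' //.
rewrite !mulmxA (hw_lower (nuW D)) // (hw_torusl (nuW D)) // -!scalemxAl.
by rewrite mxE vanish mulr0.
Qed.

End Extremal.

Lemma omega_injective Y : omega T Y = 0 -> Y = 0.
Proof.
move=> oY; apply: contrapT => /eqP Y0.
have [c c0 cE] := extremal_coefficient D.
have [Z [Z0 oZ fixZ]] := kernel_fixed D Y0 oY.
by case/eqP: Z0; apply: (kernel_fixed_eq0 c0 cE).
Qed.

End KernelTrivial.

(** * Weight multiplicities and the rank of the slices *)

Section WeightMultiplicities.
Variable R : realType.
Local Notation C := R[i].

(* Coefficients of [(L2 X^L1 - L1 X^L2 + (L1 - L2)) / (X - 1)^2], with [L1 = l1 + 2] and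
   [L2 = l2 + 1]: the Schur polynomial of [(l1, l2, 0)] at [(X, 1, 1)]. *)
Definition weight_mult (l1 l2 k : nat) : nat :=
  k.+1 * (l1.+1 - l2) + (k.+1 - l1.+2) * l2.+1 - (k.+1 - l2.+1) * l1.+2.

Lemma weight_mult_eq0 l1 l2 k : (l2 <= l1)%N -> (l1 < k)%N -> weight_mult l1 l2 k = 0%N.
Proof. by move=> l21 lt_lk; apply/eqP; rewrite subn_eq0; nia. Qed.

Definition first_weight (i : 'I_3) : nat := i == 0.

Section Multiplicity.
Variables (N l1 l2 : nat) (rho : 'M[C]_3 -> 'M[C]_N).
Hypotheses (l21 : (l2 <= l1)%N) (rhoS : schur_module (part3 l1 l2 0) rho).

(** Both sides of Jacobi's formula vanish at [(u, 1, 1)], so it is taken at [(u, v, 1)] and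
    differentiated in [v] at 1. *)
Lemma schur_at_11 u : u != 0 -> \tr (rho (torus first_weight u)) * (u - 1) ^+ 2 =
  l2.+1%:R * u ^+ l1.+2 - l1.+2%:R * u ^+ l2.+1 + (l1.+1 - l2)%:R.
Proof.
move=> u0; have [rhoG rhoP _ chi] := rhoS.
pose g : 'M[{poly C}]_3 := mx3 [:: [:: u%:P; 0; 0]; [:: 0; 'X; 0]; [:: 0; 0; 1]].
pose t v : 'I_3 -> C := nth 0 [:: u; v; 1].
have eg v : evmx v g = diag_mx (\row_i t v i).
  by apply/matrixP; apply: ord3P; apply: ord3P; rewrite !mxE /horner_eval /t /= ?hornerC ?hornerX.
have [A eA] := rep_curve rhoP g.
have t0 v : v != 0 -> forall i, t v i != 0.
  by move=> v0; apply: ord3P; rewrite /t //= oner_eq0.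
have {}eA v : v != 0 -> rho (diag_mx (\row_i t v i)) = evmx v A.
  move=> v0; rewrite -eg; apply: eA; rewrite eg; apply: diag_unit => i.
  by rewrite mxE t0.
have trA v : \tr (evmx v A) = (\tr A).[v].
  by rewrite /mxtrace horner_sum; apply: eq_bigr => i _; rewrite evmxE.
pose V : {poly C} := (u - 1)%:P * (u%:P - 'X).
pose U : {poly C} := (u ^+ l1.+2)%:P * ('X^(l2.+1) - 1) - (u ^+ l2.+1)%:P * ('X^(l1.+2) - 1)
  + ('X^(l1.+2) - 'X^(l2.+1)).
have E : \tr A * V * ('X - 1) = U.
  apply: (@poly_eq_generic _ 'X); rewrite ?polyX_eq0 // => v; rewrite hornerX => v0.
  have := chi _ (t0 _ v0); rewrite eA // trA !det3 !mxE /t /part3 /=.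
  rewrite !subnn !subn0 !(addn2, addn1, addn0) !expr1n !expr0 !expr1.
  rewrite /V /U !(hornerXn, hornerD, hornerN, hornerM, horner_exp, hornerC, hornerX) => H.
  apply: etrans (etrans H _); ring.
have dU : U^`().[1] = u ^+ l1.+2 *+ l2.+1 - u ^+ l2.+1 *+ l1.+2 + (l1.+2%:R - l2.+1%:R).
  rewrite /U; move: l1.+2 l2.+1 => L1 L2; rewrite !derivE.
  rewrite !(hornerMn, hornerXn, hornerD, hornerN, hornerM, hornerC, horner0) !expr1n.
  ring.
have := congr1 (fun p => p^`().[1]) E; rewrite dU derivM /V !derivE.
rewrite !(hornerD, hornerN, hornerM, hornerC, hornerX, horner0).
have -> : torus first_weight u = diag_mx (\row_i t 1 i).
  congr diag_mx; apply/rowP; apply: ord3P; rewrite !mxE /t /first_weight /= ?expr0 //.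
rewrite eA ?oner_eq0 // trA natrB; last exact: leqW.
move: (\tr A).[1] ((\tr A)^`().[1]) (u ^+ l1.+2) (u ^+ l2.+1) => f f' U1 U2 H.
suff -> : f * (u - 1) ^+ 2 = U1 *+ l2.+1 - U2 *+ l1.+2 + (l1.+2%:R - l2.+1%:R) by ring.
by rewrite -H; ring.
Qed.

(** The ranks are traces of idempotents, hence coefficients of the Schur polynomial at [(X, 1, 1)].
    Multiplication by [(X - 1)^2] is a second difference, which with two initial values determines
    them. *)
Lemma weight_ranks : exists A : 'M[{poly C}]_N,
  [/\ forall u, u != 0 -> rho (torus first_weight u) = evmx u A,
      forall k l, coefmx k A *m coefmx l A = if k == l then coefmx k A else 0,
      evmx 1 A = 1%:M
    & forall k, \rank (coefmx k A) = weight_mult l1 l2 k].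
Proof.
have [rhoG rhoP _ _] := rhoS.
have [A [rA AA A1]] := torus_grading rhoG rhoP first_weight.
exists A; split=> // k.
pose f : {poly C} := \tr A; pose d k := \rank (coefmx k A).
have fd j : f`_j = (d j)%:R.
  rewrite -idempotent_trace ?AA ?eqxx // /f /mxtrace coef_sum.
  by apply: eq_bigr => i _; rewrite coefmxE.
have fE : f * 'X^2 - f * 'X *+ 2 + f =
    'X^(l1.+2) *+ l2.+1 - 'X^(l2.+1) *+ l1.+2 + (l1.+1 - l2)%:R%:P.
  apply: (@poly_eq_generic _ 'X); rewrite ?polyX_eq0 // => u; rewrite hornerX => u0.
  have := schur_at_11 u0; rewrite rA //.
  have -> : \tr (evmx u A) = f.[u].
    by rewrite /f /mxtrace horner_sum; apply: eq_bigr => i _; rewrite evmxE.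
  move: l1.+2 l2.+1 (l1.+1 - l2)%N => L1 L2 L3 H.
  rewrite !(hornerMn, hornerXn, hornerD, hornerN, hornerM, hornerC, hornerX).
  by apply: etrans (etrans H _); ring.
have fEj j : (if (j < 2)%N then 0 else f`_(j - 2)) - (if j == 0%N then 0 else f`_j.-1) *+ 2 + f`_j
   = (j == l1.+2)%:R *+ l2.+1 - (j == l2.+1)%:R *+ l1.+2 + (if j == 0%N then (l1.+1 - l2)%:R else 0).
  have /(congr1 (coefp j)) := fE; move: (l1.+1 - l2)%N l1.+2 l2.+1 => L3 M1 M2.
  by rewrite /= !(coefMn, coefD, coefN, coefMXn, coefMX, coefXn, coefC).
have d0 : d 0%N = (l1.+1 - l2)%N.
  apply/eqP; rewrite -(eqr_nat C); have := fEj 0%N; rewrite /= !fd => E; apply/eqP; ring: E.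
have d1 : (d 1%N + (1 == l2.+1) * l1.+2 = 2 * d 0)%N.
  apply/eqP; rewrite -(eqr_nat C) !natrD !natrM; have := fEj 1%N; rewrite /= !fd => E.
  by apply/eqP; apply: (addrI (- (d 0%N)%:R *+ 2 - (1 == l2.+1)%N%:R *+ l1.+2)); apply: etrans (etrans E _); ring.
have dS j : (d j.+2 + d j + (j.+2 == l2.+1) * l1.+2 = 2 * d j.+1 + (j.+2 == l1.+2) * l2.+1)%N.
  apply/eqP; rewrite -(eqr_nat C) !natrD !natrM; have := fEj j.+2; rewrite /= subn2 /= !fd => E.
  apply/eqP; apply: (addrI (- (d j.+1)%:R *+ 2 - (j.+2 == l2.+1)%N%:R *+ l1.+2)).
  by apply: etrans (etrans E _); ring.
(* The truncated difference [j.+1 - L] is the coefficient of [X^j] in [X^L / (1 - X)^2]; [sec] says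
   that its second difference is the unit impulse at [L]. *)
have key j : (d j + (j.+1 - l2.+1) * l1.+2 = j.+1 * (l1.+1 - l2) + (j.+1 - l1.+2) * l2.+1)%N.
  have sec L i : ((i.+3 - L) + (i.+1 - L) = 2 * (i.+2 - L) + (i.+2 == L))%N.
    by case: eqP => [<-|]; lia.
  suff [] : (d j + (j.+1 - l2.+1) * l1.+2 = j.+1 * (l1.+1 - l2) + (j.+1 - l1.+2) * l2.+1)%N
    /\ (d j.+1 + (j.+2 - l2.+1) * l1.+2 = j.+2 * (l1.+1 - l2) + (j.+2 - l1.+2) * l2.+1)%N by [].
  elim: j => [|j [key0 key1]].
    split; first by rewrite d0 !subSS !sub0n !mul0n !addn0 mul1n.
    have -> : (2 - l2.+1 = (1 == l2.+1))%N by case: (l2) => [|[|]].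
    by rewrite (_ : 2 - l1.+2 = 0)%N ?mul0n ?addn0 ?d1 ?d0 //; lia.
  split=> //; have := dS j.
  have secM L L' : ((j.+3 - L) * L' + (j.+1 - L) * L' = 2 * ((j.+2 - L) * L') + (j.+2 == L) * L')%N.
    by rewrite -mulnDl sec mulnDl mulnA.
  move: key0 key1 (secM l2.+1 l1.+2) (secM l1.+2 l2.+1); rewrite !mulSn.
  move: (l1.+1 - l2)%N ((j.+1 - l2.+1) * l1.+2)%N ((j.+2 - l2.+1) * l1.+2)%N
    ((j.+3 - l2.+1) * l1.+2)%N ((j.+1 - l1.+2) * l2.+1)%N ((j.+2 - l1.+2) * l2.+1)%N
    ((j.+3 - l1.+2) * l2.+1)%N ((j.+2 == l2.+1) * l1.+2)%N ((j.+2 == l1.+2) * l2.+1)%N => *.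
  lia.
by rewrite /weight_mult -key addnK.
Qed.

Lemma weight_dim : N = (\sum_(k < l1.+1) weight_mult l1 l2 k)%N.
Proof.
have [A [_ AA A1 rk]] := weight_ranks.
have AP k : coefmx k A *m coefmx k A = coefmx k A by rewrite AA eqxx.
apply/eqP; rewrite -(eqr_nat C) -mxtrace1 -A1 (@evmx_sum _ _ _ _ l1.+1) => [|k lt_lk].
  rewrite raddf_sum natr_sum; apply/eqP/eq_bigr => k _.
  by rewrite /= expr1n scale1r idempotent_trace // rk.
by apply/eqP; rewrite -mxrank_eq0 rk weight_mult_eq0.
Qed.

End Multiplicity.
End WeightMultiplicities.

(** * Ranks of the combinations of slices *)

Section SliceRank.
Variable R : realType.
Local Notation C := R[i].
Variables (a b Nmu Nnu : nat).
Variables (rmu : 'M[C]_3 -> 'M[C]_Nmu) (rnu : 'M[C]_3 -> 'M[C]_Nnu).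
Variables (vmu : 'rV[C]_Nmu) (xmu : 'cV[C]_Nmu) (vnu : 'rV[C]_Nnu) (xnu : 'cV[C]_Nnu).
Variable T : 'I_3 -> 'M[C]_(Nmu, Nnu).
Hypothesis D : invariant_data a b rmu rnu vmu xmu vnu xnu T.
Hypothesis muS : schur_module (part3 (a + b + 1) a 0) rmu.
Hypothesis nuS : schur_module (part3 (a + b + 1) (a + 1) 0) rnu.

(** The weights of S_mu run from 0 to [a + b + 1]; the index [k.+1] is the shift by one under
    [T_0]. *)
Definition slice_bound (a b : nat) : nat :=
  \sum_(k < a + b + 2)
    minn (weight_mult (a + b + 1) a k) (weight_mult (a + b + 1) (a + 1) k.+1).

Lemma T0_rank : (\rank (T 0%R) <= slice_bound a b)%N.
Proof.
have [|A [rA AA A1 rkA]] := weight_ranks _ muS; first by lia.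
have [|B [rB BB B1 rkB]] := weight_ranks _ nuS; first by lia.
have TB : map_mx polyC (T 0) *m B = 'X^1 *: (A *m map_mx polyC (T 0)).
  apply: evmx_eq => u u0; rewrite evmxZXn !evmxM !evmx_polyC -rA // -rB //.
  rewrite -(inv_tensor D) ?torus_unit // sum3 !mxE /first_weight /= !mulr1n.
  by rewrite !mulr0n !scale0r !addr0.
have shift k : T 0 *m coefmx k.+1 B = coefmx k A *m T 0.
  by rewrite -coefmx_mull TB coefmxXn /= subn1 /= coefmx_mulr.
have -> : T 0 = \sum_(k < a + b + 2) coefmx k A *m T 0.
  rewrite -mulmx_suml -[LHS]mul1mx -A1 (@evmx_sum _ _ _ _ (a + b + 2)) => [|k lt_k].
    by congr (_ *m _); apply: eq_bigr => k _; rewrite expr1n scale1r.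
  by apply/eqP; rewrite -mxrank_eq0 rkA weight_mult_eq0 //; lia.
apply: (big_ind2 (fun (M : 'M_(Nmu, Nnu)) n => (\rank M <= n)%N)).
- by rewrite mxrank0.
- by move=> M n M' n' rM rM'; apply: leq_trans (mxrank_add _ _) (leq_add rM rM').
move=> k _; rewrite leq_min -rkA -rkB mxrankM_maxl /=.
by rewrite -shift mxrankM_maxr.
Qed.

Lemma extend_row (d : 'I_3 -> C) i : d i != 0 -> exists2 g : 'M[C]_3, g \in unitmx & forall j, g 0 j = d j.
Proof.
move: i; apply: ord3P => di.
- exists (mx3 [:: [:: d 0; d 1; d 2]; [:: 0; 1; 0]; [:: 0; 0; 1]]); last by apply: ord3P; rewrite mxE.
  by rewrite unitmxE unitfE det3 !mxE /= (_ : _ + _ = d 0) //; ring.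
- exists (mx3 [:: [:: d 0; d 1; d 2]; [:: 1; 0; 0]; [:: 0; 0; 1]]); last by apply: ord3P; rewrite mxE.
  by rewrite unitmxE unitfE det3 !mxE /= (_ : _ + _ = - d 1) ?oppr_eq0 //; ring.
exists (mx3 [:: [:: d 0; d 1; d 2]; [:: 1; 0; 0]; [:: 0; 1; 0]]); last by apply: ord3P; rewrite mxE.
by rewrite unitmxE unitfE det3 !mxE /= (_ : _ + _ = d 2) //; ring.
Qed.

(** A nonzero [d] is the first row of some invertible [g], and invariance at [i = 0] turns the
    combination into [T 0] up to invertible factors. *)
Lemma slice_rank (d : 'I_3 -> C) : (\rank (\sum_i d i *: T i)%R <= slice_bound a b)%N.
Proof.
have [d0|[i di]] : (forall i, d i = 0) \/ exists i, d i != 0.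
  have [/existsP[i di]|/existsPn d0] := boolP [exists i, d i != 0]; first by right; exists i.
  by left=> i; apply/eqP; rewrite -[_ == _]negbK.
  by rewrite big1 ?mxrank0 // => i _; rewrite d0 scale0r.
have [g ug gd] := extend_row di; apply: leq_trans T0_rank.
have E := inv_tensor D ug 0.
rewrite -[X in \rank X]mul1mx -(repVK (muG D) ug) -mulmxA.
apply: leq_trans (mxrankM_maxr _ _) _.
suff -> : rmu g *m (\sum_i d i *: T i) = T 0 *m rnu g by exact: mxrankM_maxl.
by rewrite -E mulmx_sumr; apply: eq_bigr => j _; rewrite gd -scalemxAr.
Qed.

End SliceRank.

(** * Border rank *)

Section BorderRank.
Variable R : realType.
Local Notation C := R[i].

(** The norm of [R[i]] takes values in [R[i]]; its real part makes the ordered field [R]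
    available. *)
Definition cabs (z : C) : R := complex.Re `|z|.

Lemma cabsE z : `|z| = (cabs z)%:C%C.
Proof. by rewrite /cabs RRe_real // normr_real. Qed.

Lemma cabs_ge0 z : 0 <= cabs z.
Proof. by have := normr_ge0 z; rewrite cabsE ler0c. Qed.

Lemma cabsM z w : cabs (z * w) = cabs z * cabs w.
Proof. by apply: complexI; rewrite -cabsE normrM !cabsE -rmorphM. Qed.

Lemma cabsD z w : cabs (z + w) <= cabs z + cabs w.
Proof. by have := ler_normD z w; rewrite !cabsE -rmorphD lecR. Qed.

Lemma cabs_eq0 z : cabs z = 0 -> z = 0.
Proof. by move=> z0; apply/eqP; rewrite -normr_eq0 cabsE z0. Qed.

Lemma cvgC_cabs (z : nat -> C) l : cvgC z l <->
  forall eps : R, 0 < eps -> exists N : nat, forall n, (N <= n)%N -> cabs (z n - l) < eps.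
Proof.
split=> H eps /H[N HN]; exists N => n /HN; first by rewrite cabsE ltcR.
by rewrite cabsE ltcR.
Qed.

Lemma cvgC_cst (c : C) : cvgC (fun=> c) c.
Proof. by move=> eps eps0; exists 0%N => n _; rewrite subrr normr0 (ltcR 0). Qed.

Lemma cvgCD (z : nat -> C) l (w : nat -> C) m : cvgC z l -> cvgC w m -> cvgC (fun n => z n + w n) (l + m).
Proof.
move=> /cvgC_cabs zl /cvgC_cabs wm; apply/cvgC_cabs => eps eps0.
have e2 : 0 < eps / 2 by lra.
have [N1 H1] := zl _ e2; have [N2 H2] := wm _ e2; exists (maxn N1 N2) => n.
rewrite geq_max => /andP[/H1 h1 /H2 h2].
rewrite (_ : _ - _ = (z n - l) + (w n - m)); last by ring.
by have := cabsD (z n - l) (w n - m); lra.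
Qed.

Lemma cvgCM (z : nat -> C) l (w : nat -> C) m : cvgC z l -> cvgC w m -> cvgC (fun n => z n * w n) (l * m).
Proof.
move=> /cvgC_cabs zl /cvgC_cabs wm; apply/cvgC_cabs => eps eps0.
pose M := 1 + cabs l + cabs m; have M1 : 1 <= M.
  by rewrite /M; have := cabs_ge0 l; have := cabs_ge0 m; lra.
have M0 : 0 < M by lra.
(* With both errors below [d <= 1], the error of the product is below [d (1 + |l| + |m|) = d M]. *)
pose d := Num.min 1 (eps / M); have d0 : 0 < d by rewrite lt_min ltr01 divr_gt0.
have [N1 H1] := zl _ d0; have [N2 H2] := wm _ d0; exists (maxn N1 N2) => n.
rewrite geq_max => /andP[/H1 h1 /H2 h2].
rewrite (_ : _ - _ = (z n - l) * (w n - m) + (l * (w n - m) + m * (z n - l))); last by ring.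
apply: le_lt_trans (cabsD _ _) _.
have {}h3 := cabsD (l * (w n - m)) (m * (z n - l)).
apply: le_lt_trans (lerD (lexx _) h3) _; rewrite !cabsM.
have dM : d * M <= eps by rewrite -ler_pdivlMr // ge_min lexx orbT.
have dle1 : d <= 1 by rewrite ge_min lexx.
apply: lt_le_trans dM; move: h1 h2 (cabs_ge0 l) (cabs_ge0 m) (cabs_ge0 (z n - l)) (cabs_ge0 (w n - m)).
rewrite /M; move: (cabs (z n - l)) (cabs (w n - m)) (cabs l) (cabs m) => x y L K; nra.
Qed.

Lemma cvgC_sum I (r : seq I) (P : pred I) (z : I -> nat -> C) l :
  (forall i, cvgC (z i) (l i)) -> cvgC (fun n => \sum_(i <- r | P i) z i n) (\sum_(i <- r | P i) l i).
Proof.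
move=> zl; elim: r => [|i r IHr].
  by rewrite big_nil; under [fun n => _]funext do rewrite big_nil; exact: cvgC_cst.
rewrite big_cons; under [fun n => _]funext do rewrite big_cons.
by case: ifP => // _; apply: cvgCD.
Qed.

Lemma cvgC_prod I (r : seq I) (P : pred I) (z : I -> nat -> C) l :
  (forall i, cvgC (z i) (l i)) -> cvgC (fun n => \prod_(i <- r | P i) z i n) (\prod_(i <- r | P i) l i).
Proof.
move=> zl; elim: r => [|i r IHr].
  by rewrite big_nil; under [fun n => _]funext do rewrite big_nil; exact: cvgC_cst.
rewrite big_cons; under [fun n => _]funext do rewrite big_cons.
by case: ifP => // _; apply: cvgCM.
Qed.

Lemma cvgC_det N (M : nat -> 'M[C]_N) (L : 'M[C]_N) :
  (forall i j, cvgC (fun n => M n i j) (L i j)) -> cvgC (fun n => \det (M n)) (\det L).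
Proof.
move=> ML; apply: cvgC_sum => s; apply: cvgCM; first exact: cvgC_cst.
exact: cvgC_prod.
Qed.

Lemma cvgC_neq0 (z : nat -> C) l : cvgC z l -> l != 0 -> exists n, z n != 0.
Proof.
move=> /cvgC_cabs zl l0; have cl0 : 0 < cabs l.
  by rewrite lt_def cabs_ge0 andbT; apply: contraNneq l0 => /cabs_eq0->.
have [N HN] := zl _ cl0; exists N; apply/eqP => zN0; have := HN _ (leqnn N).
by rewrite zN0 sub0r /cabs normrN ltxx.
Qed.

End BorderRank.

(** * The flattening and the resulting bound *)

Section BorderRankBound.
Variable R : realType.
Local Notation C := R[i].

Lemma matrix_eq_mxvec (F : fieldType) m n p (A B : 'M[F]_(m * n, p)) :
  (forall Y : 'M_(m, n), mxvec Y *m A = mxvec Y *m B) -> A = B.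
Proof.
move=> AB; apply/row_matrixP => i.
by rewrite !rowE -[delta_mx 0 i]vec_mxK AB.
Qed.

(** Acting on single rows, right multiplication by [S] factors through a space of dimension
    [\rank S]. *)
Lemma rank_lin_mulmxr (F : fieldType) m n (S : 'M[F]_(m, n)) :
  (\rank (lin_mulmxr S : 'M_(1 * m, 1 * n)) <= \rank S)%N.
Proof.
have -> : lin_mulmxr S = (lin_mulmxr (col_base S) : 'M_(1 * m, 1 * \rank S)) *m lin_mulmxr (row_base S).
  apply: matrix_eq_mxvec => Y; rewrite mulmxA !mul_vec_lin /=.
  by rewrite /mulmxr -mulmxA mulmx_base.
apply: leq_trans (mxrankM_maxl _ _) _; apply: leq_trans (rank_leq_col _) _.
by rewrite mul1n.
Qed.

(* The transposition only serves to make the matrix square. *)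
Definition omega_mx p q (T' T : 'I_3 -> 'M[C]_(p, q)) : 'M[C]_(q * p) :=
  \sum_i lin_mulmx (T' i) *m lin_mulmxr (T i) *m lin_mx trmx.

Lemma mxvec_omega_mx p q (T' T : 'I_3 -> 'M[C]_(p, q)) Y :
  mxvec Y *m omega_mx T' T = mxvec (\sum_i T' i *m Y *m T i)^T.
Proof.
rewrite mulmx_sumr !linear_sum; apply: eq_bigr => i _ /=.
by rewrite !mulmxA !mul_vec_lin.
Qed.

Definition rank1_slices p q r (x : 'I_r -> 'rV[C]_3) (y : 'I_r -> 'rV[C]_p)
    (z : 'I_r -> 'rV[C]_q) (i : 'I_3) : 'M[C]_(p, q) :=
  \sum_l x l 0 i *: ((y l)^T *m z l).

Lemma rank_omega_mx p q r d (x : 'I_r -> 'rV[C]_3) (y : 'I_r -> 'rV[C]_p) (z : 'I_r -> 'rV[C]_q)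
    (T : 'I_3 -> 'M[C]_(p, q)) :
  (forall c : 'I_3 -> C, (\rank (\sum_i c i *: T i)%R <= d)%N) ->
  (\rank (omega_mx (rank1_slices x y z) T) <= r * d)%N.
Proof.
move=> rkT; pose S l := \sum_i x l 0 i *: T i.
have -> : omega_mx (rank1_slices x y z) T =
    \sum_l lin_mulmx (z l) *m lin_mulmxr (S l) *m (lin_mulmx (y l)^T *m lin_mx trmx).
  apply: matrix_eq_mxvec => Y; rewrite mxvec_omega_mx mulmx_sumr.
  transitivity (\sum_l mxvec ((y l)^T *m (z l *m Y *m S l))^T).
    rewrite -!linear_sum /=; congr (mxvec _^T).
    under eq_bigr do rewrite !mulmx_suml.
    rewrite exchange_big; apply: eq_bigr => l _ /=.
    rewrite !mulmx_sumr; apply: eq_bigr => i _.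
    by rewrite -!scalemxAr -!scalemxAl !mulmxA.
  by apply: eq_bigr => l _; rewrite !mulmxA !mul_vec_lin /= /mulmxr !mulmxA.
rewrite -[X in (_ <= X * _)%N](card_ord r) -sum_nat_const.
apply: (big_ind2 (fun (M : 'M_(q * p)) n => (\rank M <= n)%N)).
- by rewrite mxrank0.
- by move=> M n M' n' rM rM'; apply: leq_trans (mxrank_add _ _) (leq_add rM rM').
move=> l _; apply: leq_trans (mxrankM_maxl _ _) _; apply: leq_trans (mxrankM_maxr _ _) _.
by apply: leq_trans (rank_lin_mulmxr _) (rkT _).
Qed.

Lemma cvgC_omega_mx p q (T' : nat -> 'I_3 -> 'M[C]_(p, q)) (T0 T : 'I_3 -> 'M[C]_(p, q)) :
  (forall i j k, cvgC (fun n => T' n i j k) (T0 i j k)) ->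
  forall u v, cvgC (fun n => omega_mx (T' n) T u v) (omega_mx T0 T u v).
Proof.
move=> TT u v; pose Y := vec_mx (delta_mx 0 u) : 'M[C]_(q, p).
case/mxvec_indexP: v => i j.
have E T1 : omega_mx T1 T u (mxvec_index i j) =
    \sum_k \sum_l (\sum_h T1 k j h * Y h l) * T k l i.
  transitivity (row u (omega_mx T1 T) 0 (mxvec_index i j)); first by rewrite [RHS]mxE.
  rewrite rowE -[delta_mx 0 u]vec_mxK mxvec_omega_mx mxvecE mxE summxE.
  by apply: eq_bigr => k _; rewrite mxE; apply: eq_bigr => l _; rewrite mxE.
suff cv : cvgC (fun n => \sum_k \sum_l (\sum_h T' n k j h * Y h l) * T k l i)
    (\sum_k \sum_l (\sum_h T0 k j h * Y h l) * T k l i).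
  by move=> eps /cv[N cvN]; exists N => n /cvN; rewrite -(E (T' n)) -(E T0).
apply: cvgC_sum => k; apply: cvgC_sum => l; apply: cvgCM; last exact: cvgC_cst.
by apply: cvgC_sum => h; apply: cvgCM; [exact: TT | exact: cvgC_cst].
Qed.

(** Injectivity is the nonvanishing of one determinant, which is continuous and hence nonzero at
    some approximant. Only the first factor is approximated; the second remains [S], to which the
    bound [d] applies. *)
Lemma border_rank_bound p q r d (T : tensor R 3 p q) (S := fun i => \matrix_(j, k) T i j k) :
  (forall c : 'I_3 -> C, (\rank (\sum_i c i *: S i)%R <= d)%N) ->
  (forall Y, \sum_i S i *m Y *m S i = 0 -> Y = 0) ->
  border_rank_le T r -> (p * q <= r * d)%N.
Proof.
move=> rkS inj [x [y [z Txyz]]].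
have detS : \det (omega_mx S S) != 0.
  rewrite -unitfE -unitmxE -row_free_unit -kermx_eq0; apply/eqP/row_matrixP => i.
  rewrite row0 -[row i _]vec_mxK; have -> : vec_mx (row i (kermx (omega_mx S S))) = 0.
    apply: inj; apply: trmx_inj; rewrite trmx0; apply: (can_inj mxvecK).
    by rewrite -mxvec_omega_mx vec_mxK -row_mul mulmx_ker row0 linear0.
  by rewrite linear0.
have cv : cvgC (fun n => \det (omega_mx (rank1_slices (x n) (y n) (z n)) S)) (\det (omega_mx S S)).
  apply: cvgC_det; apply: cvgC_omega_mx => i j k; rewrite mxE.
  rewrite (_ : (fun n => _) = fun n => sum_rank1 (x n) (y n) (z n) i j k) //.
  apply: funext => n; rewrite /rank1_slices /sum_rank1 summxE; apply: eq_bigr => l _.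
  by rewrite !mxE big_ord1 mxE mulrA.
have [n dn] := cvgC_neq0 cv detS.
have <- : \rank (omega_mx (rank1_slices (x n) (y n) (z n)) S) = (p * q)%N.
  rewrite [RHS]mulnC; apply/eqP; rewrite -[_ == _]/(row_free _) row_free_unit unitmxE unitfE //.
exact: rank_omega_mx.
Qed.

Lemma sum_ord_sumn n (F : nat -> nat) : (\sum_(k < n) F k)%N = sumn (mkseq F n).
Proof. by rewrite sumnE big_map -(big_mkord xpredT F) /index_iota subn0. Qed.

End BorderRankBound.

Local Close Scope ring_scope.

Theorem theorem4 (R : realType) (a b m : nat) (Nmu Nnu : nat)
    (rho_mu : 'M[R[i]]_3 -> 'M[R[i]]_Nmu) (rho_nu : 'M[R[i]]_3 -> 'M[R[i]]_Nnu)
    (T : tensor R 3 Nmu Nnu) :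
  (a, b, m) \in bound_table ->
  schur_module (part3 (a + b + 1) a 0) rho_mu ->
  schur_module (part3 (a + b + 1) (a + 1) 0) rho_nu ->
  invariant_tensor rho_mu rho_nu T ->
  nonzero_tensor T ->
  forall r : nat, border_rank_le T r -> (m <= r)%N.
Proof.
move=> tab muS nuS invT [i0 [j0 [k0 Tn0]]] r brT.
have [muG muP muI _] := muS; have [nuG nuP nuI _] := nuS.
have [|vmu [xmu muW]] := highest_weight_exists _ muS; first by lia.
have [|vnu [xnu nuW]] := highest_weight_exists _ nuS; first by lia.
pose S i := (\matrix_(j, k) T i j k)%R.
have D : invariant_data a b rho_mu rho_nu vmu xmu vnu xnu S.
  split=> // [g ug i|].
    apply/matrixP => j k; rewrite summxE [RHS]mxE; under [RHS]eq_bigr do rewrite mxE.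
    rewrite -invT //; apply: eq_bigr => i' _; rewrite !mxE mulr_sumr.
    by apply: eq_bigr => j' _; rewrite !mxE mulrA.
  exists i0; apply: contraNneq Tn0 => /matrixP/(_ j0 k0); rewrite !mxE => ->.
  exact: eqxx.
have bound := border_rank_bound (slice_rank D muS nuS) (omega_injective D) brT.
have [le_mu le_nu] : (a <= a + b + 1 /\ a + 1 <= a + b + 1)%N by lia.
have Emu := weight_dim le_mu muS; have Enu := weight_dim le_nu nuS.
(* Sums are rewritten with [sumn], which evaluates under [vm_compute]. *)
pose dim l1 l2 := sumn (mkseq (weight_mult l1 l2) l1.+1).
pose rk a' b' := sumn (mkseq (fun k =>
  minn (weight_mult (a' + b' + 1) a' k) (weight_mult (a' + b' + 1) (a' + 1) k.+1)) (a' + b' + 2)).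
(* A border rank at most [m - 1] would give [dim * dim <= (m - 1) * rk], which the numbers
   refute. *)
have table : all (fun x => let: (a', b', m') := x in
    m'.-1 * rk a' b' < dim (a' + b' + 1) a' * dim (a' + b' + 1) (a' + 1))%N bound_table.
  by vm_compute.
rewrite leqNgt; apply/negP => lt_rm.
have := allP table _ tab; rewrite /= /dim /rk.
rewrite -(sum_ord_sumn _ (weight_mult _ _)) -Emu -(sum_ord_sumn _ (weight_mult _ _)) -Enu.
rewrite -(sum_ord_sumn _ (fun k => minn _ _)) -/(slice_bound a b) ltnNge.
case/negP; apply: leq_trans bound _.
by rewrite leq_mul2r; apply/orP; right; lia.
Qed.
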